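(* Let $\mathfrak a\subset\mathfrak{gl}(5,\mathbb R)$ be the linear Lie algebra $$\mathfrak a=\left\{\begin{pmatrix} a+e_1&c&p&q&0\\ b&-a+e_1&0&p&q\\ 0&0&2a+e_2&2c&0\\ 0&0&b&e_2&c\\ 0&0&0&2b&-2a+e_2\end{pmatrix}\ :\ a,b,c,p,q,e_1,e_2\in\mathbb R\right\},$$ and let $\mathfrak a^{t}=\{A^{t}:A\in\mathfrak a\}$ be the Lie algebra of transposed matrices. Then the Sternberg prolongations of $\mathfrak a$ and of $\mathfrak a^{t}$ are both of dimension $15$, but they are non-isomorphic Lie algebras: the Sternberg prolongation of $\mathfrak a$ is isomorphic to $\mathfrak{csp}(4,\mathbb R)\ltimes\mathbb R^4$, and the Sternberg prolongation of $\mathfrak a^{t}$ is isomorphic to $\mathfrak{gl}(3,\mathbb R)\ltimes S^2(\mathbb R^3)$.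
   Context: Sternberg prolongation. For a finite-dimensional vector space $V$ let $D(V)=\bigoplus_{i\ge-1}S^{i+1}(V^* )\otimes V$ be the graded Lie algebra of polynomial vector fields on $V$, with $D_i(V)=S^{i+1}(V^* )\otimes V$, so $D_{-1}(V)=V$ and $D_0(V)=\mathfrak{gl}(V)$. The Sternberg prolongation of a subalgebra $\mathfrak a\subset\mathfrak{gl}(V)$ is the graded subalgebra $\mathfrak g=\bigoplus_{i\ge-1}\mathfrak g_i\subset D(V)$ with $\mathfrak g_{-1}=V$, $\mathfrak g_0=\mathfrak a$, and $\mathfrak g_{i+1}=\{u\in D_{i+1}(V):[u,\mathfrak g_{-1}]\subset\mathfrak g_i\}$ for $i\ge0$. It is regarded as a Lie algebra (forgetting the grading) when speaking of isomorphism. $\mathfrak{csp}(4,\mathbb R)=\mathfrak{sp}(4,\mathbb R)\oplus\mathbb R\,\mathrm{Id}$ is the conformal symplectic Lie algebra, acting on $\mathbb R^4$ in the standard way; $\mathfrak{gl}(3,\mathbb R)$ acts on $S^2(\mathbb R^3)$ in the standard way; in both semidirect products the second factor is a commutative ideal. *)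

(* Defs.v *)
From HB Require Import structures.
From mathcomp Require Import all_boot all_order all_algebra.
From mathcomp Require Import boolp reals.
From mathcomp Require Import mpoly ring.
Set Implicit Arguments.
Unset Strict Implicit.
Unset Printing Implicit Defensive.
Import GRing.Theory.
Local Open Scope ring_scope.

Lemma zmod_jacobi (V : zmodType) (a b c d e f : V) :
  (a - b - (c - d)) + (c - e - (f - b)) + (f - d - (a - e)) = 0.
Proof.
rewrite !opprB !addrA.
rewrite [LHS](ACl (1 * 12 * 2 * 7 * 3 * 10 * 4 * 5 * 6 * 11 * 8 * 9)%AC) /=.
by rewrite !(subrr, add0r, addNr).
Qed.

HB.mixin Record Lmodule_isLieAlgebra (K : fieldType) L
    of GRing.Lmodule K L := {
  lie : L -> L -> L;
  lie_linearl : forall a x y z, lie (a *: x + y) z = a *: lie x z + lie y z;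
  lie_linearr : forall a x y z, lie z (a *: x + y) = a *: lie z x + lie z y;
  liexx : forall x, lie x x = 0;
  lie_jacobi : forall x y z,
    lie x (lie y z) + lie y (lie z x) + lie z (lie x y) = 0 }.

#[short(type="lieAlgType")]
HB.structure Definition LieAlgebra (K : fieldType) :=
  { L of Lmodule_isLieAlgebra K L & GRing.Lmodule K L }.

Reserved Notation "[ 'lie' x , y ]" (at level 0, format "[ 'lie'  x ,  y ]").
Notation "[ 'lie' x , y ]" := (lie x y) : ring_scope.

Definition has_dimension (K : fieldType) (V : lmodType K) (d : nat) : Prop :=
  inhabited (Vector.axiom d V).

Definition lie_isomorphic (K : fieldType) (L M : lieAlgType K) : Prop :=
  exists f : {linear L -> M},
    bijective f /\ forall x y, f [lie x, y] = [lie f x, f y].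

Section LieTheory.
Variables (K : fieldType) (L : lieAlgType K).
Implicit Types x y z : L.

Lemma lieDl x y z : [lie x + y, z] = [lie x, z] + [lie y, z].
Proof. by rewrite -[x]scale1r lie_linearl !scale1r. Qed.

Lemma lieDr x y z : [lie z, x + y] = [lie z, x] + [lie z, y].
Proof. by rewrite -[x]scale1r lie_linearr !scale1r. Qed.

Lemma lie0x x : [lie 0, x] = 0.
Proof. by apply: (addIr [lie 0, x]); rewrite -lieDl !add0r. Qed.

Lemma liex0 x : [lie x, 0] = 0.
Proof. by apply: (addIr [lie x, 0]); rewrite -lieDr !add0r. Qed.

Lemma lieNx x y : [lie - x, y] = - [lie x, y].
Proof. by apply: (addIr [lie x, y]); rewrite -lieDl !addNr lie0x. Qed.

Lemma liexN x y : [lie x, - y] = - [lie x, y].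
Proof. by apply: (addIr [lie x, y]); rewrite -lieDr !addNr liex0. Qed.

Lemma lieC x y : [lie x, y] = - [lie y, x].
Proof.
apply/eqP; rewrite -addr_eq0; apply/eqP.
by have := liexx (x + y); rewrite lieDl !lieDr !liexx add0r addr0.
Qed.

Lemma lie_lie x y z :
  [lie [lie x, y], z] = [lie x, [lie y, z]] - [lie y, [lie x, z]].
Proof.
have := lie_jacobi x y z.
rewrite (lieC z x) liexN (lieC z [lie x, y]) => /eqP.
by rewrite subr_eq0 => /eqP.
Qed.

End LieTheory.

Definition lie_subalgebra_closed (K : fieldType) (L : lieAlgType K)
    (P : L -> Prop) : Prop :=
  [/\ P 0,
      forall a x y, P x -> P y -> P (a *: x + y) &
      forall x y, P x -> P y -> P [lie x, y]].

Record lieSub (K : fieldType) (L : lieAlgType K) := LieSub {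
  lieSub_set :> L -> Prop;
  lieSubP : lie_subalgebra_closed lieSub_set }.

Section SubLie.
Variables (K : fieldType) (L : lieAlgType K) (S : lieSub L).

Definition lieSub_pred : {pred L} := fun x => `[< S x >].

Lemma lieSub_submod_closed : submod_closed lieSub_pred.
Proof.
have [S0 SD _] := lieSubP S; split=> [|a x y /asboolP Sx /asboolP Sy].
  exact/asboolP.
exact/asboolP/SD.
Qed.
HB.instance Definition _ :=
  GRing.isSubmodClosed.Build K L lieSub_pred lieSub_submod_closed.

Record subLie := SubLie { subLie_val : L; _ : subLie_val \in lieSub_pred }.
HB.instance Definition _ := [isSub for subLie_val].
HB.instance Definition _ := [Choice of subLie by <:].
HB.instance Definition _ := [SubChoice_isSubLmodule of subLie by <:].

Lemma lieSub_pred_lie (x y : subLie) : [lie val x, val y] \in lieSub_pred.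
Proof.
have [_ _ SB] := lieSubP S.
by apply/asboolP/SB; apply/asboolP; [exact: (valP x)|exact: (valP y)].
Qed.

Definition sub_lie (x y : subLie) : subLie := SubLie (lieSub_pred_lie x y).

Lemma sub_lie_linearl a x y z :
  sub_lie (a *: x + y) z = a *: sub_lie x z + sub_lie y z.
Proof. by apply: val_inj; rewrite /= lie_linearl. Qed.

Lemma sub_lie_linearr a x y z :
  sub_lie z (a *: x + y) = a *: sub_lie z x + sub_lie z y.
Proof. by apply: val_inj; rewrite /= lie_linearr. Qed.

Lemma sub_liexx x : sub_lie x x = 0.
Proof. by apply: val_inj; rewrite /= liexx. Qed.

Lemma sub_lie_jacobi x y z :
  sub_lie x (sub_lie y z) + sub_lie y (sub_lie z x) + sub_lie z (sub_lie x y)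
  = 0.
Proof. by apply: val_inj; rewrite /= lie_jacobi. Qed.

HB.instance Definition _ := Lmodule_isLieAlgebra.Build K subLie
  sub_lie_linearl sub_lie_linearr sub_liexx sub_lie_jacobi.

End SubLie.

Record lieRep (K : fieldType) (L : lieAlgType K) (M : lmodType K) := LieRep {
  rep_act :> L -> M -> M;
  rep_linearl : forall a x y m,
    rep_act (a *: x + y) m = a *: rep_act x m + rep_act y m;
  rep_linearr : forall x, linear (rep_act x);
  rep_lie : forall x y m,
    rep_act [lie x, y] m = rep_act x (rep_act y m) - rep_act y (rep_act x m) }.

Definition semidirect (K : fieldType) (L : lieAlgType K) (M : lmodType K)
    (rho : lieRep L M) : Type := (L * M)%type.

Section Semidirect.
Variables (K : fieldType) (L : lieAlgType K) (M : lmodType K).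
Variable rho : lieRep L M.

HB.instance Definition _ := GRing.Lmodule.on (semidirect rho).

Definition semidirect_lie (x y : semidirect rho) : semidirect rho :=
  ([lie x.1, y.1], rho x.1 y.2 - rho y.1 x.2).

Lemma semidirect_lie_linearl a x y z :
  semidirect_lie (a *: x + y) z
  = a *: semidirect_lie x z + semidirect_lie y z.
Proof.
congr pair; rewrite /= ?lie_linearl // rep_linearl rep_linearr scalerBr.
by rewrite opprD addrACA.
Qed.

Lemma semidirect_lie_linearr a x y z :
  semidirect_lie z (a *: x + y)
  = a *: semidirect_lie z x + semidirect_lie z y.
Proof.
congr pair; rewrite /= ?lie_linearr // rep_linearl rep_linearr scalerBr.
by rewrite opprD addrACA.
Qed.

Lemma semidirect_liexx x : semidirect_lie x x = 0.
Proof. by congr pair; rewrite /= ?liexx ?subrr. Qed.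

Lemma repB x m1 m2 : rho x (m1 - m2) = rho x m1 - rho x m2.
Proof. by rewrite addrC -scaleN1r rep_linearr scaleN1r addrC. Qed.

Lemma semidirect_lie_jacobi x y z :
  semidirect_lie x (semidirect_lie y z) + semidirect_lie y (semidirect_lie z x)
  + semidirect_lie z (semidirect_lie x y) = 0.
Proof.
congr pair; rewrite /= ?lie_jacobi // !repB !rep_lie.
exact: zmod_jacobi.
Qed.

HB.instance Definition _ := Lmodule_isLieAlgebra.Build K (semidirect rho)
  semidirect_lie_linearl semidirect_lie_linearr
  semidirect_liexx semidirect_lie_jacobi.

End Semidirect.

Section Gl.
Variables (K : fieldType) (n : nat).
Implicit Types A B C : 'M[K]_n.

Definition mx_lie A B : 'M[K]_n := A *m B - B *m A.

Lemma mx_lie_linearl (a : K) A B C :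
  mx_lie (a *: A + B) C = a *: mx_lie A C + mx_lie B C.
Proof.
rewrite /mx_lie mulmxDl mulmxDr -scalemxAl -scalemxAr scalerBr.
by rewrite opprD addrACA.
Qed.

Lemma mx_lie_linearr (a : K) A B C :
  mx_lie C (a *: A + B) = a *: mx_lie C A + mx_lie C B.
Proof.
rewrite /mx_lie mulmxDl mulmxDr -scalemxAl -scalemxAr scalerBr.
by rewrite opprD addrACA.
Qed.

Lemma mx_liexx A : mx_lie A A = 0.
Proof. exact: subrr. Qed.

Lemma mx_lie_jacobi A B C :
  mx_lie A (mx_lie B C) + mx_lie B (mx_lie C A) + mx_lie C (mx_lie A B) = 0.
Proof.
rewrite /mx_lie !mulmxBr !mulmxBl !mulmxA; exact: zmod_jacobi.
Qed.

HB.instance Definition _ := Lmodule_isLieAlgebra.Build K 'M[K]_n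
  mx_lie_linearl mx_lie_linearr mx_liexx mx_lie_jacobi.

Lemma lie_mxE A B : [lie A, B] = A *m B - B *m A.
Proof. by []. Qed.

End Gl.

(* X stands for the vector field \sum_j X j * d/dx_j; this presents
   D(V), the direct sum of the S^(i+1)(V') (x) V with V = K^n and V' its
   dual. *)
Definition polyvf (K : fieldType) (n : nat) : Type :=
  {ffun 'I_n -> {mpoly K[n]}}.

Section Polyvf.
Variables (K : fieldType) (n : nat).

HB.instance Definition _ := GRing.Lmodule.on (polyvf K n).

Implicit Types (X Y Z : polyvf K n) (p q : {mpoly K[n]}).

Definition vf_deriv X p : {mpoly K[n]} := \sum_(i < n) X i * p^`M(i).

Definition vf_lie X Y : polyvf K n :=
  [ffun j => vf_deriv X (Y j) - vf_deriv Y (X j)].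

Lemma vf_deriv_linearl (a : K) X Y p :
  vf_deriv (a *: X + Y) p = a *: vf_deriv X p + vf_deriv Y p.
Proof.
rewrite /vf_deriv scaler_sumr -big_split; apply: eq_bigr => i _ /=.
by rewrite !ffunE mulrDl scalerAl.
Qed.

Lemma vf_deriv_linearr X : linear (vf_deriv X).
Proof.
move=> a p q; rewrite /vf_deriv scaler_sumr -big_split; apply: eq_bigr => i _ /=.
by rewrite mderivD mderivZ mulrDr scalerAr.
Qed.

Lemma vf_derivB X p q : vf_deriv X (p - q) = vf_deriv X p - vf_deriv X q.
Proof. by rewrite addrC -scaleN1r vf_deriv_linearr scaleN1r addrC. Qed.

Lemma vf_lie_linearl (a : K) X Y Z :
  vf_lie (a *: X + Y) Z = a *: vf_lie X Z + vf_lie Y Z.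
Proof.
apply/ffunP => j; rewrite !ffunE vf_deriv_linearl vf_deriv_linearr scalerBr.
by rewrite opprD addrACA.
Qed.

Lemma vf_lie_linearr (a : K) X Y Z :
  vf_lie Z (a *: X + Y) = a *: vf_lie Z X + vf_lie Z Y.
Proof.
apply/ffunP => j; rewrite !ffunE vf_deriv_linearl vf_deriv_linearr scalerBr.
by rewrite opprD addrACA.
Qed.

Lemma vf_liexx X : vf_lie X X = 0.
Proof. by apply/ffunP => j; rewrite !ffunE subrr. Qed.

Lemma vf_derivM X p q : vf_deriv X (p * q) = vf_deriv X p * q + p * vf_deriv X q.
Proof.
rewrite /vf_deriv mulr_suml mulr_sumr -big_split; apply: eq_bigr => i _ /=.
by rewrite mderivM; ring.
Qed.

Lemma vf_deriv_sum X (F : 'I_n -> {mpoly K[n]}) :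
  vf_deriv X (\sum_i F i) = \sum_i vf_deriv X (F i).
Proof.
rewrite exchange_big; apply: eq_bigr => i _ /=.
by rewrite raddf_sum mulr_sumr.
Qed.

Lemma vf_deriv2 X Y p : vf_deriv X (vf_deriv Y p) =
  \sum_i vf_deriv X (Y i) * p^`M(i)
  + \sum_i \sum_k X k * Y i * p^`M(i)^`M(k).
Proof.
rewrite vf_deriv_sum -big_split /=. apply: eq_bigr => i _ /=.
rewrite vf_derivM; congr (_ + _); rewrite mulr_sumr.
by apply: eq_bigr => k _; rewrite mulrCA mulrA.
Qed.

Lemma vf_deriv_lie X Y p :
  vf_deriv (vf_lie X Y) p = vf_deriv X (vf_deriv Y p) - vf_deriv Y (vf_deriv X p).
Proof.
rewrite !vf_deriv2 [X in _ - (_ + X)]exchange_big /=.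
rewrite [X in _ - (_ + X)](_ : _ = \sum_i \sum_k X k * Y i * p^`M(i)^`M(k)).
  rewrite opprD addrACA subrr addr0 -sumrB.
  by apply: eq_bigr => i _; rewrite ffunE mulrBl.
by apply: eq_bigr => i _; apply: eq_bigr => k _; rewrite mderiv_comm (mulrC (X k)).
Qed.

Lemma vf_lie_jacobi X Y Z :
  vf_lie X (vf_lie Y Z) + vf_lie Y (vf_lie Z X) + vf_lie Z (vf_lie X Y) = 0.
Proof.
apply/ffunP => j; rewrite !ffunE !vf_deriv_lie !vf_derivB.
exact: zmod_jacobi.
Qed.

HB.instance Definition _ := Lmodule_isLieAlgebra.Build K (polyvf K n)
  vf_lie_linearl vf_lie_linearr vf_liexx vf_lie_jacobi.

End Polyvf.

Section Prolongation.
Variables (K : fieldType) (n : nat) (a : lieSub 'M[K]_n).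
Implicit Types X Y v : polyvf K n.

Definition vf_homog (d : nat) X : Prop := forall j, X j \is d.-homog.

Definition vf_component (d : nat) X : polyvf K n :=
  [ffun j => pihomog mdeg d (X j)].

Definition linear_vf (A : 'M[K]_n) : polyvf K n :=
  [ffun i => \sum_(j < n) A i j *: 'X_j].

(* The component g_(d-1): the index d is the polynomial degree of the
   coefficients.  The identification A |-> linear_vf A of gl(n) with D_0 is an
   anti-homomorphism for the bracket of vector fields, which is harmless since
   linear_vf (- A) = - linear_vf A. *)
Fixpoint prolong_comp (d : nat) : polyvf K n -> Prop :=
  match d with
  | 0 => vf_homog 0
  | 1 => fun X => exists2 A, a A & X = linear_vf A
  | (e.+1 as e1).+1 => fun X =>
      vf_homog e1.+1 X /\
      forall v, vf_homog 0 v -> prolong_comp e1 [lie X, v]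
  end.

(* An element of D(V) lies in the direct sum of the g_i iff each of its
   homogeneous components does. *)
Definition prolong_set X : Prop :=
  forall d, prolong_comp d (vf_component d X).

Lemma vf_homog_lin d (c : K) X Y :
  vf_homog d X -> vf_homog d Y -> vf_homog d (c *: X + Y).
Proof. by move=> hX hY j; rewrite !ffunE rpredD ?rpredZ. Qed.

Lemma linear_vf_lin (c : K) A B :
  c *: linear_vf A + linear_vf B = linear_vf (c *: A + B).
Proof.
apply/ffunP => i; rewrite !ffunE scaler_sumr -big_split.
by apply: eq_bigr => j _; rewrite !mxE scalerDl scalerA.
Qed.

Lemma linear_vf0 : linear_vf 0 = 0.
Proof.
by apply/ffunP => i; rewrite !ffunE big1 // => j _; rewrite mxE scale0r.
Qed.

Lemma linear_vf_homog A : vf_homog 1 (linear_vf A).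
Proof.
by move=> i; rewrite ffunE rpred_sum // => j _; rewrite rpredZ // dhomogX /= mdeg1.
Qed.

Lemma prolong_comp_lin d (c : K) X Y :
  prolong_comp d X -> prolong_comp d Y -> prolong_comp d (c *: X + Y).
Proof.
have [_ aL _] := lieSubP a.
elim: d X Y => [|[|d] IHd] X Y.
- exact: vf_homog_lin.
- move=> [A aA ->] [B aB ->]; exists (c *: A + B); first exact: aL.
  exact: linear_vf_lin.
move=> [hX pX] [hY pY]; split; first exact: vf_homog_lin.
move=> v hv; rewrite lie_linearl; exact: IHd (pX v hv) (pY v hv).
Qed.

Lemma prolong_comp0 d : prolong_comp d 0.
Proof.
have [a0 _ _] := lieSubP a.
elim: d => [|[|d] IHd].
- by move=> j; rewrite ffunE rpred0.
- by exists 0; rewrite ?linear_vf0.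
by split=> [j|v _]; [rewrite ffunE rpred0|rewrite lie0x].
Qed.

Lemma prolong_compN d X : prolong_comp d X -> prolong_comp d (- X).
Proof.
move=> pX; have := prolong_comp_lin (-1) pX (prolong_comp0 d).
by rewrite addr0 scaleN1r.
Qed.

Lemma prolong_compD d X Y :
  prolong_comp d X -> prolong_comp d Y -> prolong_comp d (X + Y).
Proof. by move=> pX pY; rewrite -[X]scale1r; apply: prolong_comp_lin. Qed.

Lemma prolong_comp_homog d X : prolong_comp d X -> vf_homog d X.
Proof.
case: d => [|[|d]] //=; last by case.
by case=> A _ ->; apply: linear_vf_homog.
Qed.

Lemma mderiv_homog d (p : {mpoly K[n]}) i :
  p \is d.-homog -> p^`M(i) \is d.-1.-homog.
Proof.
move=> /dhomogP hp; apply/dhomogP => m; rewrite mcoeff_msupp mcoeff_mderiv.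
move=> nz; have /hp : (m + U_(i))%MM \in msupp p.
  by rewrite mcoeff_msupp; apply: contraNneq nz => ->; rewrite mul0rn.
by rewrite /= mdegD mdeg1 addn1 => <-.
Qed.

Lemma mderiv_homog0 (p : {mpoly K[n]}) i : p \is 0.-homog -> p^`M(i) = 0.
Proof.
move=> /dhomogP hp; apply/mpolyP => m; rewrite mcoeff_mderiv mcoeff0.
rewrite [_@__]memN_msupp_eq0 ?mul0rn //.
by apply/negP => /hp; rewrite /= mdegD mdeg1 addn1.
Qed.

Lemma vf_deriv_homog d e X (p : {mpoly K[n]}) :
  vf_homog d X -> p \is e.-homog -> vf_deriv X p \is (d + e).-1.-homog.
Proof.
move=> hX hp; apply: rpred_sum => i _.
case: e hp => [|e] hp; first by rewrite mderiv_homog0 // mulr0 rpred0.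
by rewrite addnS; apply: dhomogM (hX i) (mderiv_homog i hp).
Qed.

Lemma vf_lie_homog d e X Y :
  vf_homog d X -> vf_homog e Y -> vf_homog (d + e).-1 [lie X, Y].
Proof.
move=> hX hY j; rewrite ffunE rpredB //; first exact: vf_deriv_homog.
rewrite addnC; exact: vf_deriv_homog.
Qed.

Lemma subm_self (m : 'X_{1..n}) : (m - m = 0)%MM.
Proof. by apply/mnmP => i; rewrite mnmBE subnn mnm0E. Qed.

Lemma linear_vf_deriv A B j :
  vf_deriv (linear_vf A) (linear_vf B j) = linear_vf (B *m A) j.
Proof.
transitivity (\sum_i B j i *: linear_vf A i).
  apply: eq_bigr => i _; rewrite [linear_vf B j]ffunE raddf_sum /=.
  rewrite (bigD1 i) //= big1 ?addr0 => [|k ki].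
    by rewrite mderivZ mderivX mnm1E eqxx scale1r subm_self mpolyX0 -scalerAr mulr1.
  by rewrite mderivZ mderivX mnm1E (negbTE ki) scale0r scaler0.
rewrite [RHS]ffunE.
under eq_bigr do rewrite ffunE scaler_sumr.
rewrite exchange_big; apply: eq_bigr => k _.
rewrite mxE scaler_suml; apply: eq_bigr => i _; by rewrite scalerA.
Qed.

Lemma linear_vf_lie A B :
  [lie linear_vf A, linear_vf B] = linear_vf [lie B, A].
Proof.
apply/ffunP => j; rewrite ffunE !linear_vf_deriv.
have -> : [lie B, A] = -1 *: (A *m B) + B *m A.
  by rewrite lie_mxE scaleN1r addrC.
by rewrite -linear_vf_lin !ffunE scaleN1r addrC.
Qed.

Lemma prolong_comp_const d X v :
  prolong_comp d.+1 X -> vf_homog 0 v -> prolong_comp d [lie X, v].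
Proof.
move=> pX hv; case: d pX => [|d] pX; last by case: pX => _; exact.
exact: vf_lie_homog (prolong_comp_homog pX) hv.
Qed.

Lemma prolong_comp_lie d e X Y :
  prolong_comp d X -> prolong_comp e Y -> prolong_comp (d + e).-1 [lie X, Y].
Proof.
have [_ _ aB] := lieSubP a.
elim: {d e}(d + e)%N {-2}d {-2}e (erefl (d + e)%N) X Y => [|N IHN] d e.
  by case: d e => [|//] [|//] _ X Y; apply: vf_lie_homog.
case: d e => [|d] [|e] //.
- rewrite add0n => _ X Y hX pY; rewrite lieC; apply: prolong_compN.
  exact: prolong_comp_const.
- by rewrite addn0 => _ X Y pX hY; apply: prolong_comp_const.
rewrite addSn addnS => -[eN] X Y pX pY /=.
case: N eN IHN => [//|[|N]] [eN] IHN.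
  move: eN pX pY; case: d e => [|//] [|//] _ [A aA ->] [B aB' ->].
  by exists [lie B, A]; [exact: aB|exact: linear_vf_lie].
rewrite eN; split.
  by have := vf_lie_homog (prolong_comp_homog pX) (prolong_comp_homog pY);
    rewrite addSn addnS eN.
move=> v hv; rewrite lie_lie; apply: prolong_compD.
  have := IHN d.+1 e _ X _ pX (prolong_comp_const pY hv).
  by rewrite addSn eN; apply.
apply: prolong_compN.
have := IHN e.+1 d _ Y _ pY (prolong_comp_const pX hv).
by rewrite addSn addnC eN; apply.
Qed.

Lemma vf_component_lin d (c : K) X Y :
  vf_component d (c *: X + Y) = c *: vf_component d X + vf_component d Y.
Proof. by apply/ffunP => j; rewrite !ffunE linearP. Qed.

Lemma vf_component_homog d X : vf_homog d X -> vf_component d X = X.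
Proof. by move=> hX; apply/ffunP => j; rewrite ffunE pihomog_dE. Qed.

Lemma vf_component_homog_ne d e X :
  d != e -> vf_homog e X -> vf_component d X = 0.
Proof.
move=> ne hX; apply/ffunP => j; rewrite !ffunE.
by apply: pihomog_ne0 (hX j); rewrite eq_sym.
Qed.

Lemma vf_componentE X : exists N, X = \sum_(d < N) vf_component d X.
Proof.
pose N := (\max_j mmeasure mdeg (X j))%N; exists N; apply/ffunP => j.
rewrite sum_ffunE; under eq_bigr do rewrite ffunE.
by apply: pihomog_partitionE; apply: (leq_bigmax j).
Qed.

Lemma prolong_set_lin (c : K) X Y :
  prolong_set X -> prolong_set Y -> prolong_set (c *: X + Y).
Proof.
move=> pX pY d; rewrite vf_component_lin.
exact: prolong_comp_lin (pX d) (pY d).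
Qed.

Lemma prolong_comp_set d X : prolong_comp d X -> prolong_set X.
Proof.
move=> pX e; have hX := prolong_comp_homog pX.
have [->|ne] := eqVneq e d; first by rewrite vf_component_homog.
by rewrite (vf_component_homog_ne ne hX); apply: prolong_comp0.
Qed.

Lemma prolong_set_sum N (F : 'I_N -> polyvf K n) :
  (forall i, prolong_set (F i)) -> prolong_set (\sum_i F i).
Proof.
move=> pF; elim/big_ind: _ => // [|X Y pX pY].
  exact: prolong_comp_set (prolong_comp0 0).
by rewrite -[X]scale1r; apply: prolong_set_lin.
Qed.

Lemma lie_suml N (F : 'I_N -> polyvf K n) Y :
  [lie \sum_i F i, Y] = \sum_i [lie F i, Y].
Proof. by elim/big_rec2: _ => [|i A B _ <-]; rewrite ?lie0x ?lieDl. Qed.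

Lemma lie_sumr N (F : 'I_N -> polyvf K n) Y :
  [lie Y, \sum_i F i] = \sum_i [lie Y, F i].
Proof. by elim/big_rec2: _ => [|i A B _ <-]; rewrite ?liex0 ?lieDr. Qed.

Lemma prolong_set_closed : lie_subalgebra_closed prolong_set.
Proof.
split; first exact: prolong_comp_set (prolong_comp0 0).
  by move=> c X Y; apply: prolong_set_lin.
move=> X Y pX pY.
have [N ->] := vf_componentE X; have [M ->] := vf_componentE Y.
rewrite lie_suml; apply: prolong_set_sum => i.
rewrite lie_sumr; apply: prolong_set_sum => j.
exact: prolong_comp_set (prolong_comp_lie (pX i) (pY j)).
Qed.

Definition prolongation : lieSub (polyvf K n) := LieSub prolong_set_closed.

End Prolongation.

Section Transpose.
Variables (K : fieldType) (n : nat) (a : lieSub 'M[K]_n).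

Definition tr_set (A : 'M[K]_n) : Prop := exists2 B, a B & A = B^T.

Lemma tr_set_closed : lie_subalgebra_closed tr_set.
Proof.
have [a0 aL aB] := lieSubP a; split.
- by exists 0; rewrite ?trmx0.
- move=> c _ _ [A aA ->] [B aB' ->]; exists (c *: A + B); first exact: aL.
  by rewrite linearP.
move=> _ _ [A aA ->] [B aB' ->]; exists [lie B, A]; first exact: aB.
by rewrite !lie_mxE linearB /= !trmx_mul.
Qed.

Definition tr_sub : lieSub 'M[K]_n := LieSub tr_set_closed.

End Transpose.

Section A5.
Variable K : fieldType.

Definition a5_mx (a b c p q e1 e2 : K) : 'M[K]_5 :=
  \matrix_(i < 5, j < 5) nth 0 (nth [::] [::
    [:: a + e1; c;        p;          q;      0           ];
    [:: b;      - a + e1; 0;          p;      q           ];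
    [:: 0;      0;        2 * a + e2; 2 * c;  0           ];
    [:: 0;      0;        b;          e2;     c           ];
    [:: 0;      0;        0;          2 * b;  - 2 * a + e2]] i) j.

Definition a5_set (A : 'M[K]_5) : Prop :=
  exists a b c p q e1 e2, A = a5_mx a b c p q e1 e2.

Lemma ord5_ind (P : 'I_5 -> Prop) :
  P (@Ordinal 5 0 isT) -> P (@Ordinal 5 1 isT) -> P (@Ordinal 5 2 isT) ->
  P (@Ordinal 5 3 isT) -> P (@Ordinal 5 4 isT) -> forall i, P i.
Proof.
move=> P0 P1 P2 P3 P4 [m lt_m]; case: m lt_m => [|[|[|[|[|m]]]]] lt_m //.
- by rewrite (_ : Ordinal lt_m = @Ordinal 5 0 isT) //; exact: val_inj.
- by rewrite (_ : Ordinal lt_m = @Ordinal 5 1 isT) //; exact: val_inj.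
- by rewrite (_ : Ordinal lt_m = @Ordinal 5 2 isT) //; exact: val_inj.
- by rewrite (_ : Ordinal lt_m = @Ordinal 5 3 isT) //; exact: val_inj.
- by rewrite (_ : Ordinal lt_m = @Ordinal 5 4 isT) //; exact: val_inj.
Qed.

Lemma a5_set_closed : lie_subalgebra_closed a5_set.
Proof.
split.
- exists 0, 0, 0, 0, 0, 0, 0; apply/matrixP => i j; rewrite !mxE.
  by move: i j; apply: ord5_ind; apply: ord5_ind; rewrite /=; ring.
- move=> k _ _ [a [b [c [p [q [e1 [e2 ->]]]]]]]
    [a' [b' [c' [p' [q' [e1' [e2' ->]]]]]]].
  exists (k * a + a'), (k * b + b'), (k * c + c'), (k * p + p'), (k * q + q'),
    (k * e1 + e1'), (k * e2 + e2').
  apply/matrixP => i j; rewrite !mxE.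
  by move: i j; apply: ord5_ind; apply: ord5_ind; rewrite /=; ring.
move=> _ _ [a [b [c [p [q [e1 [e2 ->]]]]]]]
  [a' [b' [c' [p' [q' [e1' [e2' ->]]]]]]].
exists (c * b' - c' * b), (2 * (b * a' - b' * a)), (2 * (a * c' - a' * c)),
  ((a + e1) * p' + p * (2 * a' + e2') + q * b'
   - ((a' + e1') * p + p' * (2 * a + e2) + q' * b)),
  ((a + e1) * q' + c * p' + 2 * p * c' + q * e2'
   - ((a' + e1') * q + c' * p + 2 * p' * c + q' * e2)), 0, 0.
apply/matrixP => i j; rewrite lie_mxE !mxE !big_ord_recl !big_ord0 !mxE.
by move: i j; apply: ord5_ind; apply: ord5_ind; rewrite /=; ring.
Qed.

Definition a5 : lieSub 'M[K]_5 := LieSub a5_set_closed.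

End A5.

Section Csp.
Variables (K : fieldType) (m : nat).

Definition symplectic_form : 'M[K]_(m + m) := block_mx 0 1%:M (- 1%:M) 0.

Definition sp_set (B : 'M[K]_(m + m)) : Prop :=
  B^T *m symplectic_form + symplectic_form *m B = 0.

Definition csp_set (A : 'M[K]_(m + m)) : Prop :=
  exists B c, sp_set B /\ A = B + c%:M.

Lemma csp_set_closed : lie_subalgebra_closed csp_set.
Proof.
split.
- exists 0, 0; rewrite /sp_set trmx0 mul0mx mulmx0 addr0; split=> //.
  by rewrite raddf0 addr0.
- move=> k _ _ [A [c [sA ->]]] [B [d [sB ->]]].
  exists (k *: A + B), (k * c + d); split.
    rewrite /sp_set linearP /= mulmxDl mulmxDr -scalemxAl -scalemxAr.
    by rewrite addrACA -scalerDr sA sB scaler0 addr0.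
  by rewrite scalerDr addrACA raddfD /= scale_scalar_mx.
move=> _ _ [A [c [sA ->]]] [B [d [sB ->]]]; exists [lie A, B], 0; split.
  move: sA sB; rewrite /sp_set !lie_mxE => /eqP; rewrite addr_eq0 => /eqP sA.
  move=> /eqP; rewrite addr_eq0 => /eqP sB.
  rewrite linearB /= !trmx_mul mulmxBl mulmxBr -!mulmxA sA sB !mulmxN !mulmxA.
  by rewrite sA sB !mulNmx !opprK addrA subrK subrr.
have sK (M : 'M[K]_(m + m)) e : [lie e%:M, M] = 0.
  by rewrite lie_mxE scalar_mxC subrr.
by rewrite raddf0 addr0 lieDl !lieDr !sK (lieC A d%:M) sK oppr0 !addr0.
Qed.

Definition csp : lieSub 'M[K]_(m + m) := LieSub csp_set_closed.

Definition csp_act (A : subLie csp) (v : 'cV[K]_(m + m)) : 'cV[K]_(m + m) :=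
  val A *m v.

Lemma csp_act_linearl a A B v :
  csp_act (a *: A + B) v = a *: csp_act A v + csp_act B v.
Proof. by rewrite /csp_act /= mulmxDl scalemxAl. Qed.

Lemma csp_act_linearr A : linear (csp_act A).
Proof. by move=> a v w; rewrite /csp_act mulmxDr scalemxAr. Qed.

Lemma csp_act_lie A B v :
  csp_act [lie A, B] v = csp_act A (csp_act B v) - csp_act B (csp_act A v).
Proof. by rewrite /csp_act /= lie_mxE mulmxBl !mulmxA. Qed.

Definition csp_std : lieRep (subLie csp) 'cV[K]_(m + m) :=
  LieRep csp_act_linearl csp_act_linearr csp_act_lie.

End Csp.

Section Sym2.
Variables (K : fieldType) (n : nat).

(* Away from characteristic 2, S^2(K^n) is the space of symmetric tensors in
   K^n (x) K^n = 'M_n, where v (x) w is the matrix v *m w^T. *)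
Definition sym2_pred : {pred 'M[K]_n} := fun S => S^T == S.

Lemma sym2_submod_closed : submod_closed sym2_pred.
Proof.
split=> [|a S T /eqP sS /eqP sT]; apply/eqP; first exact: trmx0.
by rewrite linearP /= sS sT.
Qed.
HB.instance Definition _ :=
  GRing.isSubmodClosed.Build K 'M[K]_n sym2_pred sym2_submod_closed.

Record sym2 := Sym2 { sym2_val : 'M[K]_n; _ : sym2_val \in sym2_pred }.
HB.instance Definition _ := [isSub for sym2_val].
HB.instance Definition _ := [Choice of sym2 by <:].
HB.instance Definition _ := [SubChoice_isSubLmodule of sym2 by <:].

Lemma sym2_act_sym (A : 'M[K]_n) (S : sym2) :
  A *m val S + val S *m A^T \in sym2_pred.
Proof.
by apply/eqP; rewrite linearD /= !trmx_mul trmxK (eqP (valP S)) addrC.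
Qed.

(* A acts by the Leibniz rule: A (v (x) w) = A v (x) w + v (x) A w *)
Definition sym2_act (A : 'M[K]_n) (S : sym2) : sym2 := Sym2 (sym2_act_sym A S).

Lemma sym2_act_linearl (a : K) A B S :
  sym2_act (a *: A + B) S = a *: sym2_act A S + sym2_act B S.
Proof.
apply: val_inj; rewrite /= linearP /= mulmxDl mulmxDr.
by rewrite -scalemxAl -scalemxAr scalerDr addrACA.
Qed.

Lemma sym2_act_linearr A : linear (sym2_act A).
Proof.
move=> a S T; apply: val_inj; rewrite /= mulmxDl mulmxDr.
by rewrite -scalemxAl -scalemxAr scalerDr addrACA.
Qed.

Lemma sym2_act_lie (A B : 'M[K]_n) S :
  sym2_act [lie A, B] S = sym2_act A (sym2_act B S) - sym2_act B (sym2_act A S).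
Proof.
apply: val_inj; rewrite /= lie_mxE linearB /= !trmx_mul.
rewrite mulmxBl mulmxBr !mulmxDl !mulmxDr !mulmxA.
rewrite !opprD !addrA [RHS](ACl (1 * 5 * 4 * 8 * 2 * 7 * 3 * 6)%AC) /=.
by rewrite !addrK.
Qed.

Definition gl_sym2 : lieRep 'M[K]_n sym2 :=
  LieRep sym2_act_linearl sym2_act_linearr sym2_act_lie.

End Sym2.

(* Main.v *)
(** Each prolongation is realized by vector fields on a 5-dimensional
    homogeneous space: csp(4) |x R^4 acts on the affine Lagrangian subspaces of
    R^4, and gl(3) |x S^2(R^3) on the bundle with fibre S^2(R^3 / l) over the
    projective plane of lines l of R^3.  In affine charts both actions are
    polynomial of degree at most 2, with linear isotropy algebras a and a^t.
    Solving the symmetry equations for tensors shows that the first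
    prolongations are the 3-dimensional spaces of quadratic fields occurring
    there and that the second prolongations vanish.  The two algebras differ
    because S^2(R^3) is an abelian ideal of dimension 6, while every abelian
    ideal of csp(4) |x R^4 lies in R^4. *)
Require Import Defs.
From HB Require Import structures.
From mathcomp Require Import all_boot all_order all_algebra.
From mathcomp Require Import reals.
From mathcomp Require Import boolp mpoly ring lra.
Set Implicit Arguments.
Unset Strict Implicit.
Unset Printing Implicit Defensive.
Import Order.TTheory GRing.Theory Num.Theory.
Local Open Scope ring_scope.

(** * Isomorphisms of Lie algebras *)

Section LieIsomorphic.
Variable K : fieldType.
Implicit Types L M N : lieAlgType K.

(** Linearity of [g] and its compatibility with brackets are checked after applying the injective
    map [f], so a bare inverse function suffices. *)
Lemma lie_isomorphic_of_can L M (f : {linear L -> M}) (g : M -> L) :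
  cancel g f -> cancel f g -> (forall x y, f [lie x, y] = [lie f x, f y]) ->
  exists2 h : {linear M -> L}, h =1 g &
    bijective h /\ forall x y, h [lie x, y] = [lie h x, h y].
Proof.
move=> gK fK fB.
have lg : linear g by move=> c x y; apply: (can_inj fK); rewrite linearP !gK.
pose gM := GRing.isLinear.Build K M L *:%R g lg.
pose h : {linear M -> L} := HB.pack g gM.
exists h => //; split; first by exists f.
by move=> x y; apply: (can_inj fK); rewrite /= fB !gK.
Qed.

Lemma lie_isomorphic_sym L M : lie_isomorphic L M -> lie_isomorphic M L.
Proof.
move=> [f [[g fK gK] fB]].
by have [h _ hP] := lie_isomorphic_of_can gK fK fB; exists h.
Qed.

Lemma lie_isomorphic_trans L M N :
  lie_isomorphic L M -> lie_isomorphic M N -> lie_isomorphic L N.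
Proof.
move=> [f [fb fB]] [g [gb gB]]; exists (g \o f); split; first exact: bij_comp.
by move=> x y /=; rewrite fB gB.
Qed.

Lemma has_dimension_isomorphic L M d :
  lie_isomorphic L M -> has_dimension M d -> has_dimension L d.
Proof.
move=> [f [fb fB]] [[v vl vb]]; constructor.
exists (v \o f); last exact: bij_comp.
by move=> c x y /=; rewrite linearP vl.
Qed.

(** Used with [S] a prolongation and [f] a realization of an abstract algebra by vector fields:
    corestricting [f] to [S] gives a bijection, whose inverse is obtained by choice. *)
Lemma lie_isomorphic_subLie L M (S : lieSub M) (f : {linear L -> M}) :
  injective f -> (forall x, S (f x)) -> (forall y, S y -> exists x, f x = y) ->
  (forall x y, f [lie x, y] = [lie f x, f y]) ->
  lie_isomorphic (subLie S) L.
Proof.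
move=> f_inj Sf Sonto fB.
have fS x : f x \in lieSub_pred S by apply/asboolP/Sf.
pose F x : subLie S := SubLie (fS x).
have Flin : linear F by move=> c x y; apply: val_inj; rewrite /= linearP.
pose FM := GRing.isLinear.Build K L (subLie S) *:%R F Flin.
pose h : {linear L -> subLie S} := HB.pack F FM.
have onto (y : subLie S) : exists x, f x = val y.
  by apply: Sonto; apply/asboolP/(valP y).
pose g y := projT1 (cid (onto y)).
have gP y : f (g y) = val y by rewrite /g; case: cid.
have hB x y : h [lie x, y] = [lie h x, h y] by apply: val_inj; rewrite /= fB.
have gK : cancel g h by move=> y; apply: val_inj; rewrite /= gP.
have hK : cancel h g by move=> x; apply: f_inj; rewrite gP.
by have [k _ kP] := lie_isomorphic_of_can gK hK hB; exists k.
Qed.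

End LieIsomorphic.

(** * Prolongations as tensors *)

Section FirstProlongation.
Variables (K : numFieldType) (n : nat).
Implicit Types (X Y : polyvf K n) (v : 'cV[K]_n) (A : 'M[K]_n).
Implicit Types T : 'I_n -> 'M[K]_n.

Definition const_vf v : polyvf K n := [ffun j => (v j 0)%:MP].

Lemma const_vf_lin c v w :
  const_vf (c *: v + w) = c *: const_vf v + const_vf w.
Proof. by apply/ffunP => j; rewrite !ffunE !mxE mpolyCD mpolyCM mul_mpolyC. Qed.

Lemma const_vf_homog v : vf_homog 0 (const_vf v).
Proof. by move=> j; rewrite ffunE -alg_mpolyC rpredZ ?dhomog1. Qed.

Lemma homog0_const (p : {mpoly K[n]}) : p \is 0.-homog -> p = (p@_0%MM)%:MP.
Proof.
move=> hp; apply/mpolyP => m; rewrite mcoeffC; have [<-|ne] := eqVneq 0%MM m.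
  by rewrite mulr1.
rewrite mulr0; apply: (dhomog_nemf_coeff hp).
by rewrite /= mdeg_eq0 eq_sym.
Qed.

Lemma homog0_const_vf X : vf_homog 0 X -> exists v, X = const_vf v.
Proof.
move=> hX; exists (\col_j (X j)@_0%MM); apply/ffunP => j.
by rewrite ffunE mxE -homog0_const.
Qed.

Lemma lie_constE X v j :
  [lie X, const_vf v] j = - (\sum_i v i 0 *: (X j)^`M(i)).
Proof.
rewrite ffunE {1}/vf_deriv big1 => [|i _]; last by rewrite ffunE mderivC mulr0.
rewrite sub0r /vf_deriv; congr (- _); apply: eq_bigr => i _.
by rewrite ffunE mul_mpolyC.
Qed.

Definition basis_vf (k : 'I_n) := const_vf (delta_mx k 0).

Lemma lie_basisE X k j : [lie X, basis_vf k] j = - (X j)^`M(k).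
Proof.
rewrite lie_constE (bigD1 k) //= big1 ?addr0 ?mxE ?eqxx ?scale1r //.
by move=> i /negPf ne; rewrite mxE ne scale0r.
Qed.

(** A monomial of positive degree contains some variable [k], and its coefficient in [p], times a
    positive exponent, is a coefficient of the derivative along [k]. Characteristic 0 allows
    division by the exponent. *)
Lemma mderiv_homog_eq0 d (p : {mpoly K[n]}) :
  p \is d.+1.-homog -> (forall k, p^`M(k) = 0) -> p = 0.
Proof.
move=> hp dp; apply/mpolyP => m; rewrite mcoeff0.
have [dm|] := eqVneq (mdeg m) d.+1; last exact: dhomog_nemf_coeff hp.
have [k mk] : exists k, m k != 0%N.
  apply: contrapT => /forallNP m0; move: dm; rewrite mdegE big1 // => i _.
  by apply/eqP; apply: contrapT => /negP; exact: m0.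
have := congr1 (mcoeff (m - U_(k))) (dp k); rewrite mcoeff_mderiv mcoeff0.
rewrite submK; last by apply/mnm_lepP => i; rewrite mnm1E; case: eqP => // <-; rewrite lt0n.
by move/eqP; rewrite mulrn_eq0 /= => /eqP.
Qed.

Lemma homog_vf_eq d X Y : vf_homog d.+1 X -> vf_homog d.+1 Y ->
  (forall k, [lie X, basis_vf k] = [lie Y, basis_vf k]) -> X = Y.
Proof.
move=> hX hY e; apply/ffunP => j; apply/eqP; rewrite -subr_eq0; apply/eqP.
apply: (@mderiv_homog_eq0 d) => [|k]; first exact: rpredB (hX j) (hY j).
have /ffunP /(_ j) := e k; rewrite !lie_basisE => /oppr_inj.
by rewrite mderivB => ->; rewrite subrr.
Qed.

Lemma vf_homog0 d : vf_homog d (0 : polyvf K n).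
Proof. by move=> j; rewrite ffunE rpred0. Qed.

Lemma vf_lie0_eq0 d X : vf_homog d.+1 X ->
  (forall k, [lie X, basis_vf k] = 0) -> X = 0.
Proof.
by move=> hX e; apply: homog_vf_eq hX (vf_homog0 _) _ => k; rewrite e lie0x.
Qed.

Lemma linear_vf_mderiv A j k : (linear_vf A j)^`M(k) = (A j k)%:MP.
Proof.
rewrite ffunE raddf_sum /= (bigD1 k) //= big1 ?addr0 => [|i ik].
  by rewrite mderivZ mderivX mnm1E eqxx scale1r subm_self mpolyX0 alg_mpolyC.
by rewrite mderivZ mderivX mnm1E (negbTE ik) scale0r scaler0.
Qed.

Lemma linear_vf_inj : injective (@linear_vf K n).
Proof.
move=> A B e; apply/matrixP => i j; apply: (can_inj (@mpolyCK n K)).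
by rewrite -!linear_vf_mderiv e.
Qed.

Lemma linear_vfN A : linear_vf (- A) = - linear_vf A.
Proof. by rewrite -scaleN1r -[X in linear_vf X]addr0 -linear_vf_lin linear_vf0 addr0 scaleN1r. Qed.

(** [T k i j] stands for the second derivative of the component [i] along the coordinates [k] and
    [j]. *)
Definition prolong_sym T : Prop := forall k i j, T k i j = T j i k.

(** The factor 1/2 makes [linear_vf (T k)] the derivative along coordinate [k] when [T] is
    symmetric. *)
Definition quad_vf T : polyvf K n :=
  2^-1 *: [ffun i => \sum_k 'X_k * linear_vf (T k) i].

Lemma quad_vf_lin c S T : quad_vf (fun k => c *: S k + T k)
  = c *: quad_vf S + quad_vf T.
Proof.
rewrite /quad_vf scalerA (mulrC c) -scalerA -scalerDr; congr (_ *: _).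
apply/ffunP => i; rewrite !ffunE scaler_sumr -big_split; apply: eq_bigr => k _.
by rewrite -linear_vf_lin !ffunE /= mulrDr scalerAr.
Qed.

Lemma quad_vf_homog T : vf_homog 2 (quad_vf T).
Proof.
move=> j; rewrite !ffunE; apply/rpredZ/rpred_sum => k _.
by apply: (@dhomogM _ _ _ 1 _ 1); [rewrite dhomogX /= mdeg1|exact: linear_vf_homog].
Qed.

Lemma quad_vf_mderiv T i k : prolong_sym T ->
  (quad_vf T i)^`M(k) = linear_vf (T k) i.
Proof.
move=> sT; rewrite ffunE ffunE mderivZ (raddf_sum (mderiv k)) /=.
under eq_bigr do rewrite mderivM linear_vf_mderiv mderivX mnm1E.
rewrite big_split /= (bigD1 k) //= big1 => [|l /negPf->]; last by rewrite scale0r mul0r.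
rewrite eqxx scale1r subm_self mpolyX0 mul1r addr0.
under [X in _ + X]eq_bigr do rewrite sT mulrC mul_mpolyC.
rewrite ffunE -mulr2n -scaler_nat scalerA mulVf ?scale1r //.
by rewrite pnatr_eq0.
Qed.

Lemma lie_quad_basis T k : prolong_sym T ->
  [lie quad_vf T, basis_vf k] = linear_vf (- T k).
Proof.
move=> sT; rewrite linear_vfN; apply/ffunP => i.
by rewrite lie_basisE quad_vf_mderiv // [RHS]ffunE.
Qed.

(** The three terms are homogeneous of degrees 0, 1 and 2, so [vf_component] isolates each of
    them. *)
Lemma graded_vf_eq0 v A T : prolong_sym T ->
  const_vf v + linear_vf A + quad_vf T = 0 -> [/\ v = 0, A = 0 & forall k, T k = 0].
Proof.
move=> sT e.
have h0 := const_vf_homog v; have h1 := linear_vf_homog A; have h2 := quad_vf_homog T.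
have comp0 d : vf_component d (0 : polyvf K n) = 0.
  exact: vf_component_homog (vf_homog0 d).
have compD d X Y : vf_component d (X + Y) = vf_component d X + vf_component d Y.
  by rewrite -[X]scale1r vf_component_lin !scale1r.
have e0 := congr1 (vf_component 0) e; have e1 := congr1 (vf_component 1) e.
have e2 := congr1 (vf_component 2) e.
move: e0 e1 e2; rewrite !comp0 !compD.
rewrite !(vf_component_homog h0, vf_component_homog h1, vf_component_homog h2).
rewrite !(vf_component_homog_ne _ h0, vf_component_homog_ne _ h1, vf_component_homog_ne _ h2) //.
rewrite !addr0 !add0r => e0 e1 e2; split.
- apply/colP => j; have := congr1 (fun X : polyvf K n => X j) e0.
  by rewrite !ffunE mxE => /eqP; rewrite mpolyC_eq0 => /eqP.
- by apply: linear_vf_inj; rewrite e1 linear_vf0.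
move=> k; apply: linear_vf_inj; rewrite linear_vf0.
by apply/ffunP => i; rewrite -quad_vf_mderiv // e2 !ffunE mderiv0.
Qed.

Variable a : lieSub 'M[K]_n.

(** The classical first prolongation: the intersection of Hom(V, a) with the V-valued symmetric
    bilinear maps. *)
Definition first_prolong T : Prop := (forall k, a (T k)) /\ prolong_sym T.

Lemma const_vf_decomp v : const_vf v = \sum_k v k 0 *: basis_vf k.
Proof.
apply/ffunP => j; rewrite sum_ffunE ffunE (bigD1 j) //= big1 => [|k /negPf kj].
  by rewrite !ffunE mxE !eqxx mpolyC1 addr0 alg_mpolyC.
by rewrite !ffunE mxE eq_sym kj mpolyC0 scaler0.
Qed.

Lemma prolong_comp_basis d X : vf_homog d.+2 X ->
  (forall k, prolong_comp a d.+1 [lie X, basis_vf k]) -> prolong_comp a d.+2 X.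
Proof.
move=> hX pX; split=> // w /homog0_const_vf[v ->].
rewrite const_vf_decomp lie_sumr.
elim/big_ind: _ => [|Y Z|k _]; first exact: prolong_comp0.
  exact: prolong_compD.
rewrite -[_ *: _]addr0 lie_linearr liex0.
exact: prolong_comp_lin (pX k) (prolong_comp0 a d.+1).
Qed.

Lemma prolong_comp_lie_basis d X k :
  prolong_comp a d.+1 X -> prolong_comp a d [lie X, basis_vf k].
Proof. by move=> pX; apply: prolong_comp_const pX _; apply: const_vf_homog. Qed.

Lemma lieSubN A : a A -> a (- A).
Proof.
have [a0 aL _] := lieSubP a.
by move=> aA; rewrite -[- A]addr0 -scaleN1r; apply: aL.
Qed.

(** The bracket with [basis_vf k] is minus the derivative along coordinate [k], hence the signs. The
    symmetry of [T] is the equality of mixed partial derivatives. *)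
Lemma prolong_comp2P X :
  prolong_comp a 2 X <-> exists2 T, first_prolong T & X = quad_vf T.
Proof.
split=> [pX|[T [aT sT] ->]]; last first.
  apply: prolong_comp_basis (quad_vf_homog T) _ => k.
  by rewrite lie_quad_basis //; exists (- T k) => //; apply: lieSubN.
have /choice[T TP] : forall k, exists A, a A /\ [lie X, basis_vf k] = linear_vf (- A).
  move=> k; have [A aA ->] := prolong_comp_lie_basis k pX.
  by exists (- A); rewrite opprK; split=> //; exact: lieSubN.
have dX k i : (X i)^`M(k) = linear_vf (T k) i.
  have [_ /ffunP/(_ i)] := TP k; rewrite lie_basisE linear_vfN [RHS]ffunE.
  exact: oppr_inj.
have sT : prolong_sym T.
  move=> k i j; apply: (can_inj (@mpolyCK n K)).
  by rewrite -!linear_vf_mderiv -!dX mderiv_comm.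
exists T; first by split=> // k; case: (TP k).
apply: homog_vf_eq (prolong_comp_homog pX) (quad_vf_homog T) _ => k.
by rewrite lie_quad_basis //; case: (TP k).
Qed.

(* U k l is the matrix of the second derivative, along the coordinates k and l,
   of a cubic vector field. *)
Definition second_prolong_trivial : Prop :=
  forall U : 'I_n -> 'I_n -> 'M[K]_n, (forall k, first_prolong (U k)) ->
    (forall k l, U k l = U l k) -> forall k l, U k l = 0.

(** The first derivatives of a cubic element are quadratic elements, given by tensors [U l]. Mixed
    derivatives commute, so [U] is symmetric in its two indices and the hypothesis kills it. *)
Lemma prolong_comp3_eq0 X :
  second_prolong_trivial -> prolong_comp a 3 X -> X = 0.
Proof.
move=> triv pX; apply: vf_lie0_eq0 (prolong_comp_homog pX) _ => k.
have /choice[U UP] : forall k, exists T, first_prolong T /\ [lie X, basis_vf k] = - quad_vf T.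
  move=> l; have := prolong_comp_lie_basis l pX.
  move=> /prolong_compN /prolong_comp2P[T fT e]; exists T; split=> //.
  by rewrite -e opprK.
have dX l i : (X i)^`M(l) = quad_vf (U l) i.
  have [_ /ffunP/(_ i)] := UP l; rewrite lie_basisE [RHS]ffunE.
  exact: oppr_inj.
have sU l : prolong_sym (U l) by have [[]] := UP l.
have U0 l m : U l m = 0.
  apply: triv => [j|j j']; first by have [] := UP j.
  by apply: linear_vf_inj; apply/ffunP => i; rewrite -!quad_vf_mderiv // -!dX mderiv_comm.
apply/ffunP => i; rewrite lie_basisE dX [RHS]ffunE [quad_vf _ _]ffunE.
apply/eqP; rewrite oppr_eq0; apply/eqP; rewrite ffunE big1 ?scaler0 // => m _.
by rewrite U0 linear_vf0 ffunE mulr0.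
Qed.

Lemma prolong_comp_ge3_eq0 d X :
  second_prolong_trivial -> prolong_comp a d.+3 X -> X = 0.
Proof.
move=> triv; elim: d X => [|d IHd] X; first exact: prolong_comp3_eq0.
move=> pX; apply: vf_lie0_eq0 (prolong_comp_homog pX) _ => k.
exact/IHd/prolong_comp_lie_basis.
Qed.

(** Once the second prolongation vanishes so do all higher ones, and only the components of
    polynomial degree 0, 1 and 2 remain. *)
Lemma prolong_setP X : second_prolong_trivial -> prolong_set a X <->
  exists v A T, [/\ a A, first_prolong T & X = const_vf v + linear_vf A + quad_vf T].
Proof.
move=> triv; split=> [pX|[v [A [T [aA fT ->]]]]]; last first.
  have setD Y Z : prolong_set a Y -> prolong_set a Z -> prolong_set a (Y + Z).
    by move=> pY pZ; rewrite -[Y]scale1r; apply: prolong_set_lin.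
  apply: (setD); first apply: (setD).
  - by apply: (@prolong_comp_set _ _ a 0); apply: const_vf_homog.
  - by apply: (@prolong_comp_set _ _ a 1); exists A.
  by apply: (@prolong_comp_set _ _ a 2); apply/prolong_comp2P; exists T.
have [v e0] := homog0_const_vf (pX 0).
have [A aA e1] := pX 1%N; have /prolong_comp2P[T fT e2] := pX 2.
exists v, A, T; split=> //; rewrite -e0 -e1 -e2.
apply/eqP; rewrite -subr_eq0; apply/eqP.
(* The difference is the sum of its own components: those of degree at most 2 cancel, those of
   degree at least 3 vanish by [triv]. *)
have [N ->] := vf_componentE (X - (vf_component 0 X + vf_component 1 X + vf_component 2 X)).
rewrite big1 // => -[d _] _ /=.
have compC e : vf_component d (vf_component e X) = if d == e then vf_component e X else 0.
  have hX : vf_homog e (vf_component e X) by move=> j; rewrite ffunE; apply: pihomogP.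
  by case: eqP => [->|/eqP ne]; [rewrite vf_component_homog|apply: vf_component_homog_ne hX].
have compD Y Z : vf_component d (Y + Z) = vf_component d Y + vf_component d Z.
  by rewrite -[Y]scale1r vf_component_lin !scale1r.
rewrite addrC -scaleN1r vf_component_lin !compD !compC scaleN1r.
case: d {compC compD} => [|[|[|d]]] /=; rewrite ?addr0 ?add0r ?addNr ?oppr0 ?add0r //.
by apply: prolong_comp_ge3_eq0 triv (pX _).
Qed.

End FirstProlongation.

(** * Indices and sums over three, four and five elements *)

Local Notation o0 := (@Ordinal 5 0 isT).
Local Notation o1 := (@Ordinal 5 1 isT).
Local Notation o2 := (@Ordinal 5 2 isT).
Local Notation o3 := (@Ordinal 5 3 isT).
Local Notation o4 := (@Ordinal 5 4 isT).

Local Notation i0 := (@Ordinal 4 0 isT).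
Local Notation i1 := (@Ordinal 4 1 isT).
Local Notation i2 := (@Ordinal 4 2 isT).
Local Notation i3 := (@Ordinal 4 3 isT).
Local Notation j0 := (@Ordinal 3 0 isT).
Local Notation j1 := (@Ordinal 3 1 isT).
Local Notation j2 := (@Ordinal 3 2 isT).

Lemma ord3_ind (P : 'I_3 -> Prop) : P j0 -> P j1 -> P j2 -> forall i, P i.
Proof.
move=> P0 P1 P2 [m lt_m]; case: m lt_m => [|[|[|m]]] lt_m //.
- by rewrite (_ : Ordinal lt_m = j0) //; exact: val_inj.
- by rewrite (_ : Ordinal lt_m = j1) //; exact: val_inj.
- by rewrite (_ : Ordinal lt_m = j2) //; exact: val_inj.
Qed.

Lemma ord4_ind (P : 'I_4 -> Prop) :
  P i0 -> P i1 -> P i2 -> P i3 -> forall i, P i.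
Proof.
move=> P0 P1 P2 P3 [m lt_m]; case: m lt_m => [|[|[|[|m]]]] lt_m //.
- by rewrite (_ : Ordinal lt_m = i0) //; exact: val_inj.
- by rewrite (_ : Ordinal lt_m = i1) //; exact: val_inj.
- by rewrite (_ : Ordinal lt_m = i2) //; exact: val_inj.
- by rewrite (_ : Ordinal lt_m = i3) //; exact: val_inj.
Qed.

Lemma sum_ord3 (V : nmodType) (F : 'I_3 -> V) : \sum_i F i = F j0 + F j1 + F j2.
Proof.
rewrite !big_ord_recl big_ord0 addr0 !addrA.
by do !congr (_ + _); congr F; apply: val_inj.
Qed.

Lemma sum_ord4 (V : nmodType) (F : 'I_4 -> V) :
  \sum_i F i = F i0 + F i1 + F i2 + F i3.
Proof.
rewrite !big_ord_recl big_ord0 addr0 !addrA.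
by do !congr (_ + _); congr F; apply: val_inj.
Qed.

Lemma sum_ord5 (V : nmodType) (F : 'I_5 -> V) :
  \sum_i F i = F o0 + F o1 + F o2 + F o3 + F o4.
Proof.
rewrite !big_ord_recl big_ord0 addr0 !addrA.
by do !congr (_ + _); congr F; apply: val_inj.
Qed.

(** * Prolongations of [a5] and of its transpose *)

Section A5Prolong.
Variable K : realFieldType.

(* The derivatives along x0, ..., x4 of the quadratic field (X C y, X C X) with
   C = [s, t; t, u], in the coordinates of [csp_vf] below. *)
Definition a5_tensor (s t u : K) (k : 'I_5) : 'M[K]_5 :=
  nth 0 [:: a5_mx 0 0 0 s t 0 0;
            a5_mx 0 0 0 t u 0 0;
            a5_mx (s / 2) 0 t 0 0 (s / 2) s;
            a5_mx 0 s u 0 0 t (2 * t);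
            a5_mx (- u / 2) t 0 0 0 (u / 2) u] k.

Lemma a5_tensorP s t u : first_prolong (a5 K) (a5_tensor s t u).
Proof.
split; first by apply: ord5_ind; rewrite /a5_tensor /=; do 7 eexists; reflexivity.
by do 3 apply: ord5_ind; rewrite /a5_tensor /= !mxE //=; field.
Qed.

Lemma a5_tensor_uniq (T : 'I_5 -> 'M[K]_5) : first_prolong (a5 K) T ->
  T = a5_tensor (T o0 o0 o2) (T o0 o0 o3) (T o1 o0 o3).
Proof.
move=> [aT sT].
have [a0 [b0 [c0 [p0 [q0 [e0 [f0 E0]]]]]]] := aT o0.
have [a1 [b1 [c1 [p1 [q1 [e1 [f1 E1]]]]]]] := aT o1.
have [a2 [b2 [c2 [p2 [q2 [e2 [f2 E2]]]]]]] := aT o2.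
have [a3 [b3 [c3 [p3 [q3 [e3 [f3 E3]]]]]]] := aT o3.
have [a4 [b4 [c4 [p4 [q4 [e4 [f4 E4]]]]]]] := aT o4.
have S k j : [/\ T k o0 j = T j o0 k, T k o1 j = T j o1 k, T k o2 j = T j o2 k,
  T k o3 j = T j o3 k & T k o4 j = T j o4 k] by split.
(* Matrices of [a5] vanish in rows 2 to 4 of columns 0 and 1. By symmetry rows 2 and 3 of [T o0],
   and likewise of [T o1], vanish in columns 2 and 3. *)
have [a0E b0E c0E f0E] : [/\ a0 = 0, b0 = 0, c0 = 0 & f0 = 0].
  have := S o0 o2; have := S o0 o3; rewrite E0 E2 E3 !mxE /=.
  by case=> _ _ ? ? _; case=> _ _ ? ? _; split; lra.
have [a1E b1E c1E f1E] : [/\ a1 = 0, b1 = 0, c1 = 0 & f1 = 0].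
  have := S o1 o2; have := S o1 o3; rewrite E1 E2 E3 !mxE /=.
  by case=> _ _ ? ? _; case=> _ _ ? ? _; split; lra.
move: (S o0 o1); rewrite E0 E1 !mxE /=; subst=> -[e1E e0E _ _ _].
move: (S o0 o2) (S o0 o3) (S o0 o4) (S o1 o2) (S o1 o3) (S o1 o4) (S o2 o3) (S o2 o4) (S o3 o4).
rewrite E0 E1 E2 E3 E4 !mxE /=.
case=> ? ? _ _ _; case=> ? ? _ _ _; case=> ? ? _ _ _.
case=> ? ? _ _ _; case=> ? ? _ _ _; case=> ? ? _ _ _.
case=> ? ? ? ? ?; case=> ? ? ? ? ?; case=> ? ? ? ? ?.
apply/funext; apply: ord5_ind; rewrite ?E0 ?E1 ?E2 ?E3 ?E4 /a5_tensor /=.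
all: congr a5_mx; lra.
Qed.

Lemma a5_tensor0 k : a5_tensor 0 0 0 k = 0 :> 'M[K]_5.
Proof.
apply/matrixP => i j; rewrite [RHS]mxE; move: k i j.
by do 3 apply: ord5_ind; rewrite /a5_tensor mxE /= ?(mulr0, mul0r, oppr0, addr0).
Qed.

Lemma a5_second_prolong_trivial : second_prolong_trivial (a5 K).
Proof.
move=> U fU sU.
have /choice[s /choice[t /choice[u E]]] : forall k, exists s t u, U k = a5_tensor s t u.
  by move=> k; do 3 eexists; apply: a5_tensor_uniq.
have H k l i j : a5_tensor (s k) (t k) (u k) l i j = a5_tensor (s l) (t l) (u l) k i j.
  by rewrite -!E sU.
(* The matrix of any [a5_tensor] along [x0] or [x1] has zero upper left 2 by 2 block. Exchanging the
   two indices of [U] carries this to its matrices along [x2] and [x4], where that block shows the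
   parameters. *)
have s0 : s o0 = 0 by have := H o0 o2 o0 o0; rewrite /a5_tensor !mxE /=; lra.
have t0 : t o0 = 0 by have := H o0 o2 o0 o1; rewrite /a5_tensor !mxE /=; lra.
have u0 : u o0 = 0 by have := H o0 o4 o1 o1; rewrite /a5_tensor !mxE /=; lra.
(* Now [U o0] is zero, so [U l o0] is zero, and its first row contains [s l] and [t l]. In the same
   way [U l o1] contains [u l]. *)
have sl l : s l = 0.
  by have := H o0 l o0 o2; rewrite s0 t0 u0 a5_tensor0 /a5_tensor !mxE.
have tl l : t l = 0.
  by have := H o0 l o0 o3; rewrite s0 t0 u0 a5_tensor0 /a5_tensor !mxE.
have u1 : u o1 = 0 by have := H o1 o4 o1 o1; rewrite /a5_tensor !mxE /=; lra.
have ul l : u l = 0.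
  by have := H o1 l o0 o3; rewrite sl tl u1 a5_tensor0 /a5_tensor !mxE.
by move=> k l; rewrite E sl tl ul a5_tensor0.
Qed.

(* The derivatives of ((k^T y) y, y k^T Z + Z k y^T - s y y^T) with k = (c, d), in
   the coordinates of [gl_vf] below. *)
Definition a5t_tensor (c d s : K) (k : 'I_5) : 'M[K]_5 :=
  (nth 0 [:: a5_mx (c / 2) d 0 (- 2 * s) 0 (3 * c / 2) c;
             a5_mx (- d / 2) 0 c 0 (- 2 * s) (3 * d / 2) d;
             a5_mx 0 0 0 (2 * c) 0 0 0;
             a5_mx 0 0 0 d c 0 0;
             a5_mx 0 0 0 0 (2 * d) 0 0] k)^T.

Lemma a5t_tensorP c d s : first_prolong (tr_sub (a5 K)) (a5t_tensor c d s).
Proof.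
split.
  by apply: ord5_ind; rewrite /a5t_tensor /=; eexists; last reflexivity; do 7 eexists; reflexivity.
by do 3 apply: ord5_ind; rewrite /a5t_tensor /= !mxE //=; field.
Qed.

Lemma a5t_tensor0 k : a5t_tensor 0 0 0 k = 0 :> 'M[K]_5.
Proof.
apply/matrixP => i j; rewrite [RHS]mxE; move: k i j.
by do 3 apply: ord5_ind; rewrite /a5t_tensor !mxE /= ?(mulr0, mul0r, oppr0, addr0).
Qed.

Lemma a5t_tensor_uniq (T : 'I_5 -> 'M[K]_5) : first_prolong (tr_sub (a5 K)) T ->
  T = a5t_tensor (T o0 o1 o1) (T o0 o0 o1) (- T o0 o2 o0 / 2).
Proof.
move=> [aT sT].
have [_ [a0 [b0 [c0 [p0 [q0 [e0 [f0 ->]]]]]]] E0] := aT o0.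
have [_ [a1 [b1 [c1 [p1 [q1 [e1 [f1 ->]]]]]]] E1] := aT o1.
have [_ [a2 [b2 [c2 [p2 [q2 [e2 [f2 ->]]]]]]] E2] := aT o2.
have [_ [a3 [b3 [c3 [p3 [q3 [e3 [f3 ->]]]]]]] E3] := aT o3.
have [_ [a4 [b4 [c4 [p4 [q4 [e4 [f4 ->]]]]]]] E4] := aT o4.
have S k j : [/\ T k o0 j = T j o0 k, T k o1 j = T j o1 k, T k o2 j = T j o2 k,
  T k o3 j = T j o3 k & T k o4 j = T j o4 k] by split.
(* Transposed matrices vanish in columns 2 to 4 of rows 0 and 1. By symmetry the upper left 2 by 2
   blocks of [T o2], [T o3] and [T o4] vanish. *)
have [a2E b2E c2E e2E] : [/\ a2 = 0, b2 = 0, c2 = 0 & e2 = 0].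
  have := S o0 o2; have := S o1 o2; rewrite E0 E1 E2 !mxE /=.
  by case=> ? ? _ _ _; case=> ? ? _ _ _; split; lra.
have [a3E b3E c3E e3E] : [/\ a3 = 0, b3 = 0, c3 = 0 & e3 = 0].
  have := S o0 o3; have := S o1 o3; rewrite E0 E1 E3 !mxE /=.
  by case=> ? ? _ _ _; case=> ? ? _ _ _; split; lra.
have [a4E b4E c4E e4E] : [/\ a4 = 0, b4 = 0, c4 = 0 & e4 = 0].
  have := S o0 o4; have := S o1 o4; rewrite E0 E1 E4 !mxE /=.
  by case=> ? ? _ _ _; case=> ? ? _ _ _; split; lra.
move: (S o0 o1) (S o0 o2) (S o0 o3) (S o0 o4) (S o1 o2) (S o1 o3) (S o1 o4).
move: (S o2 o3) (S o2 o4).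
rewrite E0 E1 E2 E3 E4 !mxE /=; subst.
case=> _ _ ? ? _; case=> _ _ ? ? ?.
case=> ? ? ? ? ?; case=> _ _ ? ? _; case=> _ _ ? ? ?.
case=> _ _ ? ? ?; case=> _ _ ? ? ?; case=> _ _ ? ? ?; case=> _ _ ? ? ?.
apply/funext; apply: ord5_ind; rewrite ?E0 ?E1 ?E2 ?E3 ?E4 /a5t_tensor /=.
all: congr (_^T); congr a5_mx; lra.
Qed.

Lemma a5t_second_prolong_trivial : second_prolong_trivial (tr_sub (a5 K)).
Proof.
move=> U fU sU.
have /choice[c /choice[d /choice[s E]]] : forall k, exists c d s, U k = a5t_tensor c d s.
  by move=> k; do 3 eexists; apply: a5t_tensor_uniq.
have H k l i j : a5t_tensor (c k) (d k) (s k) l i j = a5t_tensor (c l) (d l) (s l) k i j.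
  by rewrite -!E sU.
(* In an [a5t_tensor] the parameter [q] of the matrix along [x0] and the parameter [p] of the matrix
   along [x1] are zero. Exchanging the indices of [U] turns this into equations for the parameters
   of [U o0] and [U o1]. *)
have c0 : c o0 = 0 by have := H o0 o3 o3 o0; rewrite /a5t_tensor !mxE /=; lra.
have d0 : d o0 = 0 by have := H o0 o4 o3 o0; rewrite /a5t_tensor !mxE /=; lra.
have s0 : s o0 = 0 by have := H o0 o1 o3 o0; rewrite /a5t_tensor !mxE /=; lra.
have c1 : c o1 = 0 by have := H o1 o2 o2 o0; rewrite /a5t_tensor !mxE /=; lra.
have d1 : d o1 = 0 by have := H o1 o3 o2 o0; rewrite /a5t_tensor !mxE /=; lra.
have s1 : s o1 = 0 by have := H o0 o1 o2 o0; rewrite /a5t_tensor !mxE /=; lra.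
(* For the remaining [k], [U k o0 = U o0 k = 0], and the matrix along [x0] involves all three
   parameters. *)
have Z k : [/\ c k = 0, d k = 0 & s k = 0].
  move: k; apply: ord5_ind; split=> //.
  - by have := H o0 o2 o0 o0; rewrite /a5t_tensor !mxE /=; lra.
  - by have := H o0 o2 o0 o1; rewrite /a5t_tensor !mxE /=; lra.
  - by have := H o0 o2 o2 o0; rewrite /a5t_tensor !mxE /= c0; lra.
  - by have := H o0 o3 o0 o0; rewrite /a5t_tensor !mxE /=; lra.
  - by have := H o0 o3 o0 o1; rewrite /a5t_tensor !mxE /=; lra.
  - by have := H o0 o3 o2 o0; rewrite /a5t_tensor !mxE /= d0; lra.
  - by have := H o0 o4 o0 o0; rewrite /a5t_tensor !mxE /=; lra.
  - by have := H o0 o4 o0 o1; rewrite /a5t_tensor !mxE /=; lra.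
  - by have := H o0 o4 o2 o0; rewrite /a5t_tensor !mxE /=; lra.
by move=> k l; rewrite E; have [-> -> ->] := Z k; apply: a5t_tensor0.
Qed.

End A5Prolong.

(** * Vector fields of the csp(4) action *)

Section Csp4.
Variable K : realFieldType.

Lemma symplectic_form2E : symplectic_form K 2 =
  \matrix_(i < 4, j < 4) nth 0 (nth [::] [::
    [:: 0; 0; 1; 0]; [:: 0; 0; 0; 1]; [:: -1; 0; 0; 0]; [:: 0; -1; 0; 0]] i) j.
Proof.
apply/matrixP => i j; rewrite [RHS]mxE /symplectic_form.
case: (split_ordP i) => {}i ->; case: (split_ordP j) => {}j ->.
- rewrite block_mxEul mxE; move: i j.
  by do 2 (case=> [[|[|?]]] // ?).
- rewrite block_mxEur mxE; move: i j.
  by do 2 (case=> [[|[|?]]] // ?).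
- rewrite block_mxEdl !mxE; move: i j.
  by do 2 (case=> [[|[|?]]] // ?); rewrite /= ?oppr0.
rewrite block_mxEdr mxE; move: i j.
by do 2 (case=> [[|[|?]]] // ?).
Qed.

(** For [M] = [P, B; C, Q]: B and C are symmetric and Q + P^T is scalar. *)
Definition csp_eqs (M : 'M[K]_(2 + 2)) : Prop :=
  [/\ M i1 i2 = M i0 i3, M i3 i0 = M i2 i1, M i2 i3 = - M i1 i0, M i3 i2 = - M i0 i1
    & M i3 i3 = M i2 i2 + M i0 i0 - M i1 i1].

Lemma csp_setP (M : 'M[K]_(2 + 2)) : csp_set M <-> csp_eqs M.
Proof.
rewrite /csp_set /sp_set symplectic_form2E; split.
  move=> [B [c [/matrixP sB ->]]].
  move: (sB i0 i1) (sB i0 i2) (sB i0 i3) (sB i1 i2) (sB i1 i3) (sB i2 i3).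
  rewrite /csp_eqs !mxE !sum_ord4 !mxE /= => e01 e02 e03 e12 e13 e23; split; lra.
(* The scalar matrix Q + P^T equals 2c, because the symplectic part contributes zero to it. *)
move=> [e12 e30 e23 e32 e33]; pose c := (M i0 i0 + M i2 i2) / 2.
exists (M - c%:M), c; split; last by rewrite subrK.
apply/matrixP => i j; rewrite !mxE ?sum_ord4 ?mxE.
move: i j; apply: ord4_ind; apply: ord4_ind; rewrite /= ?e12 ?e30 ?e23 ?e32 ?e33 /c.
all: by rewrite ?mulr1n ?mulr0n; field.
Qed.

End Csp4.

Lemma quad_vfE (K : numFieldType) n (T : 'I_n -> 'M[K]_n) (X : polyvf K n) :
  (forall i, \sum_k 'X_k * linear_vf (T k) i = 2 *: X i) -> quad_vf T = X.
Proof.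
move=> e; apply/ffunP => i; rewrite ffunE ffunE e.
by rewrite scalerA mulVf ?scale1r ?pnatr_eq0.
Qed.

Lemma vf_lie5E (K : fieldType) (X Y : polyvf K 5) j : [lie X, Y] j =
  X o0 * (Y j)^`M(o0) + X o1 * (Y j)^`M(o1) + X o2 * (Y j)^`M(o2)
  + X o3 * (Y j)^`M(o3) + X o4 * (Y j)^`M(o4)
  - (Y o0 * (X j)^`M(o0) + Y o1 * (X j)^`M(o1) + Y o2 * (X j)^`M(o2)
  + Y o3 * (X j)^`M(o3) + Y o4 * (X j)^`M(o4)).
Proof. by rewrite ffunE /vf_deriv !sum_ord5. Qed.

Section CspFields.
Variable K : realFieldType.

Local Notation P5 := {mpoly K[5]}.
Local Notation "'x0" := ('X_o0 : P5).
Local Notation "'x1" := ('X_o1 : P5).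
Local Notation "'x2" := ('X_o2 : P5).
Local Notation "'x3" := ('X_o3 : P5).
Local Notation "'x4" := ('X_o4 : P5).

Lemma quad_a5_tensorE (s t u : K) : quad_vf (a5_tensor s t u) = [ffun i : 'I_5 => nth 0
  [:: 'x2 * (s%:MP * 'x0 + t%:MP * 'x1) + 'x3 * (t%:MP * 'x0 + u%:MP * 'x1);
      'x3 * (s%:MP * 'x0 + t%:MP * 'x1) + 'x4 * (t%:MP * 'x0 + u%:MP * 'x1);
      s%:MP * 'x2 ^+ 2 + 2 * t%:MP * 'x2 * 'x3 + u%:MP * 'x3 ^+ 2;
      s%:MP * 'x2 * 'x3 + t%:MP * ('x2 * 'x4 + 'x3 ^+ 2) + u%:MP * 'x3 * 'x4;
      s%:MP * 'x3 ^+ 2 + 2 * t%:MP * 'x3 * 'x4 + u%:MP * 'x4 ^+ 2] i].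
Proof.
have hK x : 2 * x / 2 = x :> K by field.
have hN x : - (2 * x) / 2 = - x :> K by field.
(* Doubling the parameters clears the halves in the tensor, leaving an identity that [ring] can
   decide over polynomials. *)
have [s' ->] : exists s', s = 2 * s' by exists (s / 2); field.
have [t' ->] : exists t', t = 2 * t' by exists (t / 2); field.
have [u' ->] : exists u', u = 2 * u' by exists (u / 2); field.
rewrite /a5_tensor !hK !hN; apply: quad_vfE => i.
rewrite sum_ord5 /= !ffunE !sum_ord5 !mxE /= -!mul_mpolyC.
by move: i; apply: ord5_ind; rewrite /=; ring.
Qed.

Lemma a5_mx_lin (k a b c p q e f a' b' c' p' q' e' f' : K) :
  a5_mx (k * a + a') (k * b + b') (k * c + c') (k * p + p') (k * q + q')
    (k * e + e') (k * f + f') = k *: a5_mx a b c p q e f + a5_mx a' b' c' p' q' e' f'.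
Proof.
apply/matrixP => i j; rewrite !mxE.
by move: i j; apply: ord5_ind; apply: ord5_ind; rewrite /=; ring.
Qed.

Lemma a5_tensor_lin (c s t u s' t' u' : K) :
  a5_tensor (c * s + s') (c * t + t') (c * u + u')
  = (fun k => c *: a5_tensor s t u k + a5_tensor s' t' u' k).
Proof.
apply/funext; apply: ord5_ind; rewrite /a5_tensor /= -a5_mx_lin.
all: by congr a5_mx; field.
Qed.

(* Minus the infinitesimal action of csp(4) |x R^4 on the affine Lagrangian
   subspaces {(X q + y, q)}, with y = (x0, x1) and X = [x2, x3; x3, x4]:
   [P, B; C, Q] and (v, w) move X by P X + B - X Q - X C X and
   y by P y + v - X C y - X w. *)
Definition csp_vf (M : 'M[K]_(2 + 2)) (v : 'cV[K]_(2 + 2)) : polyvf K 5 :=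
  const_vf (\col_(i < 5) nth 0 [:: - v i0 0; - v i1 0; - M i0 i2; - M i0 i3; - M i1 i3] i)
  + linear_vf (a5_mx ((M i1 i1 - M i0 i0) / 2) (- M i1 i0) (- M i0 i1) (v i2 0) (v i3 0)
      (- (M i0 i0 + M i1 i1) / 2) (M i2 i2 - M i1 i1))
  + quad_vf (a5_tensor (M i2 i0) (M i2 i1) (M i3 i1)).

Lemma csp_vf_lin c M M' v v' :
  csp_vf (c *: M + M') (c *: v + v') = c *: csp_vf M v + csp_vf M' v'.
Proof.
have mE i j : (c *: M + M') i j = c * M i j + M' i j by rewrite !mxE.
have vE i : (c *: v + v') i 0 = c * v i 0 + v' i 0 by rewrite !mxE.
rewrite /csp_vf !mE !vE a5_tensor_lin quad_vf_lin.
set A := a5_mx _ _ _ _ _ _ _; set A1 := a5_mx _ _ _ _ _ _ _; set A2 := a5_mx _ _ _ _ _ _ _.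
have -> : A = c *: A1 + A2 by rewrite -a5_mx_lin; congr a5_mx; field.
rewrite -linear_vf_lin.
set w := (X in const_vf X); set w1 := (X in _ = _ *: (const_vf X + _ + _) + _).
set w2 := (X in _ = _ + (const_vf X + _ + _)).
have -> : w = c *: w1 + w2.
  by apply/colP; apply: ord5_ind; rewrite !mxE /=; ring.
by rewrite const_vf_lin !scalerDr [RHS]addrACA [X in X + _ = _]addrACA.
Qed.

(** The components of [csp_vf] written out, with [csp_jac] below as their Jacobian matrix, so that
    brackets reduce to explicit polynomial identities. *)
Definition csp_poly (N : 'M[K]_(2 + 2)) (w : 'cV[K]_(2 + 2)) (i : 'I_5) : P5 :=
  let M i j := (N i j)%:MP in let v i := (w i 0)%:MP in
  nth 0 [:: - v i0 - M i0 i0 * 'x0 - M i0 i1 * 'x1 + v i2 * 'x2 + v i3 * 'x3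
      + 'x2 * (M i2 i0 * 'x0 + M i2 i1 * 'x1) + 'x3 * (M i2 i1 * 'x0 + M i3 i1 * 'x1);
      - v i1 - M i1 i0 * 'x0 - M i1 i1 * 'x1 + v i2 * 'x3 + v i3 * 'x4
      + 'x3 * (M i2 i0 * 'x0 + M i2 i1 * 'x1) + 'x4 * (M i2 i1 * 'x0 + M i3 i1 * 'x1);
      - M i0 i2 + (M i2 i2 - M i0 i0) * 'x2 - 2 * M i0 i1 * 'x3
      + M i2 i0 * 'x2 ^+ 2 + 2 * M i2 i1 * 'x2 * 'x3 + M i3 i1 * 'x3 ^+ 2;
      - M i0 i3 - M i1 i0 * 'x2 + (M i2 i2 - M i1 i1) * 'x3 - M i0 i1 * 'x4
      + M i2 i0 * 'x2 * 'x3 + M i2 i1 * ('x2 * 'x4 + 'x3 ^+ 2) + M i3 i1 * 'x3 * 'x4;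
      - M i1 i3 - 2 * M i1 i0 * 'x3 + (M i2 i2 + M i0 i0 - 2 * M i1 i1) * 'x4
      + M i2 i0 * 'x3 ^+ 2 + 2 * M i2 i1 * 'x3 * 'x4 + M i3 i1 * 'x4 ^+ 2] i.

Lemma csp_vfE N w i : csp_vf N w i = csp_poly N w i.
Proof.
(* Half sum and half difference of the diagonal entries as new unknowns again remove the divisions
   by 2. *)
have [a [e [E0 E1]]] : exists a e, N i0 i0 = - (a + e) /\ N i1 i1 = a - e.
  by exists ((N i1 i1 - N i0 i0) / 2), (- (N i0 i0 + N i1 i1) / 2); split; field.
rewrite /csp_vf quad_a5_tensorE.
have -> : (N i1 i1 - N i0 i0) / 2 = a by rewrite E0 E1; field.
have -> : - (N i0 i0 + N i1 i1) / 2 = e by rewrite E0 E1; field.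
rewrite /csp_poly E0 E1 !ffunE sum_ord5 !mxE -!mul_mpolyC.
by move: i; apply: ord5_ind; rewrite /=; ring.
Qed.

Lemma mderiv_var i j : ('X_i : P5)^`M(j) = (i == j)%:R%:MP.
Proof.
rewrite mderivX mnm1E; case: eqP => [->|_]; last by rewrite scale0r.
by rewrite subm_self mpolyX0 scale1r.
Qed.

Definition csp_jac (N : 'M[K]_(2 + 2)) (w : 'cV[K]_(2 + 2)) (i j : 'I_5) : P5 :=
  let M i j := (N i j)%:MP in let v i := (w i 0)%:MP in
  let s := M i2 i0 in let t := M i2 i1 in let u := M i3 i1 in
  nth 0 (nth [::] [::
    [:: - M i0 i0 + s * 'x2 + t * 'x3; - M i0 i1 + t * 'x2 + u * 'x3;
        v i2 + s * 'x0 + t * 'x1; v i3 + t * 'x0 + u * 'x1; 0];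
    [:: - M i1 i0 + s * 'x3 + t * 'x4; - M i1 i1 + t * 'x3 + u * 'x4;
        0; v i2 + s * 'x0 + t * 'x1; v i3 + t * 'x0 + u * 'x1];
    [:: 0; 0; M i2 i2 - M i0 i0 + 2 * s * 'x2 + 2 * t * 'x3;
        - 2 * M i0 i1 + 2 * t * 'x2 + 2 * u * 'x3; 0];
    [:: 0; 0; - M i1 i0 + s * 'x3 + t * 'x4;
        M i2 i2 - M i1 i1 + s * 'x2 + 2 * t * 'x3 + u * 'x4; - M i0 i1 + t * 'x2 + u * 'x3];
    [:: 0; 0; 0; - 2 * M i1 i0 + 2 * s * 'x3 + 2 * t * 'x4;
        M i2 i2 + M i0 i0 - 2 * M i1 i1 + 2 * t * 'x3 + 2 * u * 'x4]] i) j.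
Lemma csp_vf_mderiv N w i j : (csp_vf N w i)^`M(j) = csp_jac N w i j.
Proof.
rewrite csp_vfE /csp_poly /csp_jac -[2]mpolyC_nat.
move: i j; do 2 apply: ord5_ind; rewrite /= ?expr2.
all: by rewrite !(mderivD, mderivB, mderivN, mderivM, mderivC, mderiv_var) /=; ring.
Qed.

(** An infinitesimal action reverses brackets of vector fields; the minus sign built into [csp_vf]
    restores them. The proof is a comparison of components. *)
Lemma csp_vf_lie (M N : 'M[K]_(2 + 2)) (v w : 'cV[K]_(2 + 2)) :
  csp_eqs M -> csp_eqs N ->
  csp_vf [lie M, N] (M *m w - N *m v) = [lie csp_vf M v, csp_vf N w].
Proof.
move=> [M12 M30 M23 M32 M33] [N12 N30 N23 N32 N33].
have LE i j : [lie M, N] i j = M i i0 * N i0 j + M i i1 * N i1 j + M i i2 * N i2 j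
  + M i i3 * N i3 j - (N i i0 * M i0 j + N i i1 * M i1 j + N i i2 * M i2 j + N i i3 * M i3 j).
  by rewrite lie_mxE !mxE !sum_ord4.
have wE i : (M *m w - N *m v) i 0 = M i i0 * w i0 0 + M i i1 * w i1 0 + M i i2 * w i2 0
  + M i i3 * w i3 0 - (N i i0 * v i0 0 + N i i1 * v i1 0 + N i i2 * v i2 0 + N i i3 * v i3 0).
  by rewrite !mxE !sum_ord4.
(* The bracket is now opaque and known only through its entries, which leaves polynomial identities
   in these entries and in [x0], ..., [x4]. *)
move: [lie M, N] (M *m w - N *m v) LE wE => L x LE wE.
move: (csp_vf L x) (csp_vf M v) (csp_vf N w) (csp_vfE L x) (csp_vfE M v) (csp_vfE N w)
  (csp_vf_mderiv M v) (csp_vf_mderiv N w) => Z X Y EZ EX EY dX dY.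
apply/ffunP => i; rewrite vf_lie5E !dX !dY !EX !EY EZ.
rewrite /csp_poly /csp_jac; move: i; apply: ord5_ind.
all: rewrite /= ?LE ?wE ?M12 ?M30 ?M23 ?M32 ?M33 ?N12 ?N30 ?N23 ?N32 ?N33.
all: ring.
Qed.

End CspFields.

(** * Vector fields of the gl(3) action *)

Section GlFields.
Variable K : realFieldType.

Local Notation P5 := {mpoly K[5]}.
Local Notation "'x0" := ('X_o0 : P5).
Local Notation "'x1" := ('X_o1 : P5).
Local Notation "'x2" := ('X_o2 : P5).
Local Notation "'x3" := ('X_o3 : P5).
Local Notation "'x4" := ('X_o4 : P5).

Lemma a5t_tensor_lin (k c d s c' d' s' : K) :
  a5t_tensor (k * c + c') (k * d + d') (k * s + s')
  = (fun i => k *: a5t_tensor c d s i + a5t_tensor c' d' s' i).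
Proof.
apply/funext; apply: ord5_ind; rewrite /a5t_tensor /= -linearP -a5_mx_lin.
all: by congr (_^T); congr a5_mx; field.
Qed.

Lemma quad_a5t_tensorE (c d s : K) : quad_vf (a5t_tensor c d s) = [ffun i : 'I_5 => nth 0
  [:: (c%:MP * 'x0 + d%:MP * 'x1) * 'x0;
      (c%:MP * 'x0 + d%:MP * 'x1) * 'x1;
      (2 * c%:MP * 'x2 + d%:MP * 'x3) * 'x0 - s%:MP * 'x0 ^+ 2;
      (c%:MP * 'x3 + 2 * d%:MP * 'x4) * 'x0 + (2 * c%:MP * 'x2 + d%:MP * 'x3) * 'x1
      - 2 * s%:MP * 'x0 * 'x1;
      (c%:MP * 'x3 + 2 * d%:MP * 'x4) * 'x1 - s%:MP * 'x1 ^+ 2] i].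
Proof.
have hK x : 2 * x / 2 = x :> K by field.
have hN x : - (2 * x) / 2 = - x :> K by field.
have h3 x : 3 * (2 * x) / 2 = 3 * x :> K by field.
have [c' ->] : exists c', c = 2 * c' by exists (c / 2); field.
have [d' ->] : exists d', d = 2 * d' by exists (d / 2); field.
rewrite /a5t_tensor !hK !hN !h3; apply: quad_vfE => i.
rewrite sum_ord5 /= !ffunE !sum_ord5 !mxE /= -!mul_mpolyC.
by move: i; apply: ord5_ind; rewrite /=; ring.
Qed.

(* Minus the infinitesimal action of gl(3) |x S^2(R^3) on the bundle with fibre
   S^2(R^3 / l) over the projective plane of lines l: for l spanned by
   (y, 1) with y = (x0, x1), and R^3 / l identified with R^2 by
   (u, t) |-> u - t y, the point of the fibre is Z = [x2, x3/2; x3/2, x4].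
   The matrix [P, b; c^T, d] moves y by P y + b - (d + c^T y) y and Z by
   N Z + Z N^T with N = P - y c^T, and S translates Z by its image. *)
Definition gl_vf (M S : 'M[K]_3) : polyvf K 5 :=
  const_vf (\col_(i < 5) nth 0
    [:: - M j0 j2; - M j1 j2; - S j0 j0; - 2 * S j0 j1; - S j1 j1] i)
  + linear_vf (a5_mx ((M j1 j1 - M j0 j0) / 2) (- M j0 j1) (- M j1 j0) (2 * S j0 j2)
      (2 * S j1 j2) (M j2 j2 - (M j0 j0 + M j1 j1) / 2) (- (M j0 j0 + M j1 j1)))^T
  + quad_vf (a5t_tensor (M j2 j0) (M j2 j1) (S j2 j2)).

Lemma gl_vf_lin c M M' S S' :
  gl_vf (c *: M + M') (c *: S + S') = c *: gl_vf M S + gl_vf M' S'.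
Proof.
have mE N N' i j : (c *: N + N' : 'M[K]_3) i j = c * N i j + N' i j by rewrite !mxE.
rewrite /gl_vf !mE a5t_tensor_lin quad_vf_lin.
set A := a5_mx _ _ _ _ _ _ _; set A1 := a5_mx _ _ _ _ _ _ _; set A2 := a5_mx _ _ _ _ _ _ _.
have -> : A = c *: A1 + A2 by rewrite -a5_mx_lin; congr a5_mx; field.
rewrite linearP -linear_vf_lin.
set w := (X in const_vf X); set w1 := (X in _ = _ *: (const_vf X + _ + _) + _).
set w2 := (X in _ = _ + (const_vf X + _ + _)).
have -> : w = c *: w1 + w2.
  by apply/colP; apply: ord5_ind; rewrite !mxE /=; ring.
by rewrite const_vf_lin !scalerDr [RHS]addrACA [X in X + _ = _]addrACA.
Qed.

Definition gl_poly (N T : 'M[K]_3) (i : 'I_5) : P5 :=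
  let M i j := (N i j)%:MP in let S i j := (T i j)%:MP in
  let c := M j2 j0 in let d := M j2 j1 in let s := S j2 j2 in
  nth 0
  [:: - M j0 j2 + (M j2 j2 - M j0 j0) * 'x0 - M j0 j1 * 'x1 + (c * 'x0 + d * 'x1) * 'x0;
      - M j1 j2 - M j1 j0 * 'x0 + (M j2 j2 - M j1 j1) * 'x1 + (c * 'x0 + d * 'x1) * 'x1;
      - S j0 j0 + 2 * S j0 j2 * 'x0 - 2 * M j0 j0 * 'x2 - M j0 j1 * 'x3
      + (2 * c * 'x2 + d * 'x3) * 'x0 - s * 'x0 ^+ 2;
      - 2 * S j0 j1 + 2 * S j1 j2 * 'x0 + 2 * S j0 j2 * 'x1 - 2 * M j1 j0 * 'x2
      - (M j0 j0 + M j1 j1) * 'x3 - 2 * M j0 j1 * 'x4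
      + (c * 'x3 + 2 * d * 'x4) * 'x0 + (2 * c * 'x2 + d * 'x3) * 'x1 - 2 * s * 'x0 * 'x1;
      - S j1 j1 + 2 * S j1 j2 * 'x1 - M j1 j0 * 'x3 - 2 * M j1 j1 * 'x4
      + (c * 'x3 + 2 * d * 'x4) * 'x1 - s * 'x1 ^+ 2] i.

Lemma gl_vfE N T i : gl_vf N T i = gl_poly N T i.
Proof.
have [a [e [E0 E1]]] : exists a e, N j0 j0 = - a - e /\ N j1 j1 = a - e.
  by exists ((N j1 j1 - N j0 j0) / 2), (- (N j0 j0 + N j1 j1) / 2); split; field.
rewrite /gl_vf quad_a5t_tensorE.
have -> : (N j1 j1 - N j0 j0) / 2 = a by rewrite E0 E1; field.
have -> : N j2 j2 - (N j0 j0 + N j1 j1) / 2 = N j2 j2 + e by rewrite E0 E1; field.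
rewrite /gl_poly E0 E1 !ffunE sum_ord5 !mxE -!mul_mpolyC.
by move: i; apply: ord5_ind; rewrite /=; ring.
Qed.

Definition gl_jac (N T : 'M[K]_3) (i j : 'I_5) : P5 :=
  let M i j := (N i j)%:MP in let S i j := (T i j)%:MP in
  let c := M j2 j0 in let d := M j2 j1 in let s := S j2 j2 in
  nth 0 (nth [::] [::
    [:: M j2 j2 - M j0 j0 + 2 * c * 'x0 + d * 'x1; - M j0 j1 + d * 'x0; 0; 0; 0];
    [:: - M j1 j0 + c * 'x1; M j2 j2 - M j1 j1 + c * 'x0 + 2 * d * 'x1; 0; 0; 0];
    [:: 2 * S j0 j2 + 2 * c * 'x2 + d * 'x3 - 2 * s * 'x0; 0;
        - 2 * M j0 j0 + 2 * c * 'x0; - M j0 j1 + d * 'x0; 0];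
    [:: 2 * S j1 j2 + c * 'x3 + 2 * d * 'x4 - 2 * s * 'x1;
        2 * S j0 j2 + 2 * c * 'x2 + d * 'x3 - 2 * s * 'x0;
        - 2 * M j1 j0 + 2 * c * 'x1; - (M j0 j0 + M j1 j1) + c * 'x0 + d * 'x1;
        - 2 * M j0 j1 + 2 * d * 'x0];
    [:: 0; 2 * S j1 j2 + c * 'x3 + 2 * d * 'x4 - 2 * s * 'x1; 0;
        - M j1 j0 + c * 'x1; - 2 * M j1 j1 + 2 * d * 'x1]] i) j.

Lemma gl_vf_mderiv N T i j : (gl_vf N T i)^`M(j) = gl_jac N T i j.
Proof.
rewrite gl_vfE /gl_poly /gl_jac -[2]mpolyC_nat.
move: i j; do 2 apply: ord5_ind; rewrite /= ?expr2.
all: by rewrite !(mderivD, mderivB, mderivN, mderivM, mderivC, mderiv_var) /=; ring.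
Qed.

(** As for csp(4), the sign in [gl_vf] turns the action into a homomorphism. Symmetry reduces [S]
    and [T] to their upper triangles before [ring]. *)
Lemma gl_vf_lie (M N S T : 'M[K]_3) : S^T = S -> T^T = T ->
  gl_vf [lie M, N] (M *m T + T *m M^T - (N *m S + S *m N^T))
  = [lie gl_vf M S, gl_vf N T].
Proof.
move=> sS sT.
have S10 i j : S i j = S j i by rewrite -{1}sS mxE.
have T10 i j : T i j = T j i by rewrite -{1}sT mxE.
have LE i j : [lie M, N] i j = M i j0 * N j0 j + M i j1 * N j1 j + M i j2 * N j2 j
  - (N i j0 * M j0 j + N i j1 * M j1 j + N i j2 * M j2 j).
  by rewrite lie_mxE !mxE !sum_ord3.
have wE i j : (M *m T + T *m M^T - (N *m S + S *m N^T)) i j =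
  M i j0 * T j0 j + M i j1 * T j1 j + M i j2 * T j2 j
  + (T i j0 * M j j0 + T i j1 * M j j1 + T i j2 * M j j2)
  - (N i j0 * S j0 j + N i j1 * S j1 j + N i j2 * S j2 j
  + (S i j0 * N j j0 + S i j1 * N j j1 + S i j2 * N j j2)).
  by rewrite !mxE !sum_ord3 !mxE.
move: [lie M, N] (_ - _) LE wE => L U LE wE.
move: (gl_vf L U) (gl_vf M S) (gl_vf N T) (gl_vfE L U) (gl_vfE M S) (gl_vfE N T)
  (gl_vf_mderiv M S) (gl_vf_mderiv N T) => Z X Y EZ EX EY dX dY.
apply/ffunP => i; rewrite vf_lie5E !dX !dY !EX !EY EZ.
rewrite /gl_poly /gl_jac; move: i; apply: ord5_ind; rewrite /= ?LE ?wE.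
all: rewrite ?(S10 j1 j0) ?(S10 j2 j0) ?(S10 j2 j1) ?(T10 j1 j0) ?(T10 j2 j0) ?(T10 j2 j1).
all: ring.
Qed.

End GlFields.

(** * The two isomorphisms and the dimension 15 *)

Section ProlongationIsomorphisms.
Variable K : realFieldType.

Lemma csp_valP (A : subLie (csp K 2)) : csp_eqs (val A).
Proof. by apply/csp_setP/asboolP; apply: (valP A). Qed.

(* The matrix [P, B; C, Q] of csp(4) with Q determined by P and Q_00. *)
Definition csp_mx (p00 p01 p10 p11 q00 b00 b01 b11 c00 c01 c11 : K) : 'M[K]_(2 + 2) :=
  \matrix_(i < 4, j < 4) nth 0 (nth [::] [::
    [:: p00; p01; b00; b01];
    [:: p10; p11; b01; b11];
    [:: c00; c01; q00; - p10];
    [:: c01; c11; - p01; q00 + p00 - p11]] i) j.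

Lemma csp_mxP p00 p01 p10 p11 q00 b00 b01 b11 c00 c01 c11 :
  csp_mx p00 p01 p10 p11 q00 b00 b01 b11 c00 c01 c11 \in lieSub_pred (csp K 2).
Proof. by apply/asboolP/csp_setP; split; rewrite !mxE. Qed.

Lemma csp_mxE (M : 'M[K]_(2 + 2)) : csp_eqs M ->
  M = csp_mx (M i0 i0) (M i0 i1) (M i1 i0) (M i1 i1) (M i2 i2) (M i0 i2) (M i0 i3)
    (M i1 i3) (M i2 i0) (M i2 i1) (M i3 i1).
Proof.
move=> [M12 M30 M23 M32 M33]; apply/matrixP => i j; rewrite mxE.
by move: i j; apply: ord4_ind; apply: ord4_ind.
Qed.

(** The constant, linear and quadratic parts vanish separately, and their entries determine the
    eleven parameters of [M] and the four of [v]. *)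
Lemma csp_vf_eq0 (M : 'M[K]_(2 + 2)) v : csp_eqs M -> csp_vf M v = 0 -> M = 0 /\ v = 0.
Proof.
move=> /csp_mxE EM; have [_ sT] := a5_tensorP (M i2 i0) (M i2 i1) (M i3 i1).
case/(graded_vf_eq0 sT) => /colP ev /matrixP eA eT.
have := (ev o0, ev o1, ev o2, ev o3, ev o4).
have := (eA o0 o0, eA o0 o1, eA o1 o0, eA o1 o1, eA o0 o2, eA o0 o3, eA o3 o3).
have /matrixP/(_ o0) c0 := eT o0; have /matrixP/(_ o0) c1 := eT o1.
have := (c0 o2, c0 o3, c1 o3); rewrite {ev eA eT c0 c1 sT} /a5_tensor !mxE /=.
have -> : v = \col_(i < 4) nth 0 [:: v i0 0; v i1 0; v i2 0; v i3 0] i.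
  by apply/colP => i; rewrite mxE; move: i; apply: ord4_ind.
rewrite [X in X = 0 /\ _]EM !mxE /=.
move: (M i0 i0) (M i0 i1) (M i1 i0) (M i1 i1) (M i2 i2) (M i0 i2) (M i0 i3)
    (M i1 i3) (M i2 i0) (M i2 i1) (M i3 i1) (v i0 0) (v i1 0) (v i2 0) (v i3 0).
move=> p00 p01 p10 p11 q00 b00 b01 b11 c00 c01 c11 v0 v1 v2 v3.
case=> [[-> ->] ->] [[[[[[a00 a01] a10] a11] -> ] ->] e2] [[[[d0 d1] d2] d3] d4].
have -> : v0 = 0 by lra. have -> : v1 = 0 by lra.
have -> : b00 = 0 by lra. have -> : b01 = 0 by lra. have -> : b11 = 0 by lra.
have -> : p01 = 0 by lra. have -> : p10 = 0 by lra.
have p00E : p00 = 0 by lra. have p11E : p11 = 0 by lra.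
have -> : q00 = 0 by lra.
rewrite p00E p11E; split.
  apply/matrixP => i j; rewrite !mxE; move: i j.
  by apply: ord4_ind; apply: ord4_ind; rewrite /= ?oppr0 ?addr0 ?subrr.
by apply/colP => i; rewrite !mxE; move: i; apply: ord4_ind.
Qed.

(** The three graded parts of [csp_vf] fill the constant fields, [a5] and the first prolongation,
    with 5, 7 and 3 parameters. *)
Lemma prolongation_a5_csp :
  lie_isomorphic (subLie (prolongation (a5 K))) (semidirect (csp_std K 2)).
Proof.
pose f (z : semidirect (csp_std K 2)) := csp_vf (val z.1) z.2.
have f_lin : linear f by move=> c x y; rewrite /f -csp_vf_lin.
pose fM := GRing.isLinear.Build K _ _ *:%R f f_lin.
pose F : {linear semidirect (csp_std K 2) -> polyvf K 5} := HB.pack f fM.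
apply: (@lie_isomorphic_subLie K _ _ (prolongation (a5 K)) F).
- apply: raddf_inj => -[A v]; rewrite /= /f /=.
  case/(csp_vf_eq0 (csp_valP A)) => A0 ->.
  by congr pair; apply: val_inj.
- move=> [A v]; apply/(prolong_setP _ (@a5_second_prolong_trivial K)).
  rewrite /= /f /csp_vf; do 3 eexists; split; last reflexivity; [by do 7 eexists|exact: a5_tensorP].
- move=> X /(prolong_setP _ (@a5_second_prolong_trivial K)) [v [_ [T [
    [a [b [c [p [q [e1 [e2 ->]]]]]]] /a5_tensor_uniq -> ->]]]].
  move: (T o0 o0 o2) (T o0 o0 o3) (T o1 o0 o3) => s t u.
  (* [A] and [w] come from solving the formula of [csp_vf] for the prescribed graded parts. *)
  pose A : subLie (csp K 2) := SubLie (csp_mxP (- a - e1) (- c) (- b) (a - e1) (e2 + a - e1)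
    (- v o2 0) (- v o3 0) (- v o4 0) s t u).
  pose w : 'cV[K]_4 := \col_(i < 4) nth 0 [:: - v o0 0; - v o1 0; p; q] i.
  exists (A, w); rewrite /= /f /csp_vf !mxE /=.
  congr (const_vf _ + linear_vf _ + quad_vf _).
    by apply/colP => i; rewrite !mxE; move: i; apply: ord5_ind; rewrite /= opprK.
  by congr a5_mx; field.
move=> [A v] [B w]; rewrite /= /f /=.
exact: csp_vf_lie (csp_valP A) (csp_valP B).
Qed.

Definition csp_coord (M : 'M[K]_(2 + 2)) (v : 'cV[K]_(2 + 2)) : 'rV[K]_15 :=
  \row_(i < 15) nth 0 [:: M i0 i0; M i0 i1; M i1 i0; M i1 i1; M i2 i2; M i0 i2; M i0 i3;
    M i1 i3; M i2 i0; M i2 i1; M i3 i1; v i0 0; v i1 0; v i2 0; v i3 0] i.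

Lemma csp_coord_lin c M N v w :
  csp_coord (c *: M + N) (c *: v + w) = c *: csp_coord M v + csp_coord N w.
Proof.
apply/rowP => -[m lt_m]; rewrite /csp_coord !mxE.
by do 15 (case: m lt_m => [|m] lt_m; first by rewrite /= ?mxE).
Qed.

Lemma csp_std_dimension : has_dimension (semidirect (csp_std K 2)) 15.
Proof.
constructor.
exists (fun z : semidirect (csp_std K 2) => csp_coord (val z.1) z.2).
  by move=> c x y; rewrite -csp_coord_lin.
pose r (x : 'rV[K]_15) m (lt_m : (m < 15)%N) := x 0 (Ordinal lt_m).
exists (fun x : 'rV[K]_15 => (SubLie (csp_mxP (@r x 0 isT) (@r x 1 isT) (@r x 2 isT) (@r x 3 isT)
   (@r x 4 isT) (@r x 5 isT) (@r x 6 isT) (@r x 7 isT) (@r x 8 isT) (@r x 9 isT) (@r x 10 isT)),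
   \col_(i < 4) nth 0 [:: @r x 11 isT; @r x 12 isT; @r x 13 isT; @r x 14 isT] i)).
  move=> [A v]; congr pair.
    by apply: val_inj; rewrite /= /r !mxE /= -csp_mxE //; exact: csp_valP.
  by apply/colP => i; rewrite /r !mxE /=; move: i; apply: ord4_ind.
move=> x; apply/rowP => -[m lt_m]; rewrite mxE /=.
do 15 (case: m lt_m => [|m] lt_m; first by rewrite /= ?mxE /= /r; congr (x 0 _); apply: val_inj).
by [].
Qed.

Lemma gl_vf_eq0 (M S : 'M[K]_3) : S^T = S -> gl_vf M S = 0 -> M = 0 /\ S = 0.
Proof.
move=> sS; have [_ sT] := a5t_tensorP (M j2 j0) (M j2 j1) (S j2 j2).
have S10 i j : S i j = S j i by rewrite -{1}sS mxE.
case/(graded_vf_eq0 sT) => /colP ev /matrixP eA eT.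
have := (ev o0, ev o1, ev o2, ev o3, ev o4).
have := (eA o0 o0, eA o1 o0, eA o0 o1, eA o1 o1, eA o2 o0, eA o3 o0, eA o3 o3).
have /matrixP/(_ o0) c0 := eT o0; have /matrixP/(_ o1) c1 := eT o0.
have /matrixP/(_ o2) c2 := eT o0.
have := (c1 o1, c0 o1, c2 o0); rewrite {ev eA eT c0 c1 c2 sT} /a5t_tensor !mxE /=.
have ME (N : 'M[K]_3) : N = \matrix_(i < 3, j < 3) nth 0 (nth [::] [::
    [:: N j0 j0; N j0 j1; N j0 j2]; [:: N j1 j0; N j1 j1; N j1 j2];
    [:: N j2 j0; N j2 j1; N j2 j2]] i) j.
  by apply/matrixP => i j; rewrite mxE; move: i j; apply: ord3_ind; apply: ord3_ind.
rewrite [X in X = 0 /\ _]ME [X in _ /\ X = 0]ME.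
rewrite (S10 j1 j0) (S10 j2 j0) (S10 j2 j1).
move: (M j0 j0) (M j0 j1) (M j0 j2) (M j1 j0) (M j1 j1) (M j1 j2) (M j2 j0) (M j2 j1) (M j2 j2).
move: (S j0 j0) (S j0 j1) (S j0 j2) (S j1 j1) (S j1 j2) (S j2 j2).
move=> s00 s01 s02 s11 s12 s22 p00 p01 p02 p10 p11 p12 p20 p21 p22.
case=> [[e20 e21] e22] [[[[[[a00 a01] a10] a11] a20] a30] a33] [[[[d0 d1] d2] d3] d4].
have -> : p20 = 0 by lra. have -> : p21 = 0 by lra. have -> : s22 = 0 by lra.
have -> : p02 = 0 by lra. have -> : p12 = 0 by lra.
have -> : s00 = 0 by lra. have -> : s01 = 0 by lra. have -> : s11 = 0 by lra.
have -> : s02 = 0 by lra. have -> : s12 = 0 by lra.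
have -> : p01 = 0 by lra. have -> : p10 = 0 by lra.
have -> : p00 = 0 by lra. have -> : p11 = 0 by lra. have -> : p22 = 0 by lra.
by split; apply/matrixP => i j; rewrite !mxE; move: i j; apply: ord3_ind; apply: ord3_ind.
Qed.

Lemma sym2_valP n (S : sym2 K n) : (val S)^T = val S.
Proof. exact/eqP/(valP S). Qed.

Definition sym3_mx (s00 s01 s02 s11 s12 s22 : K) : 'M[K]_3 :=
  \matrix_(i < 3, j < 3) nth 0 (nth [::] [::
    [:: s00; s01; s02]; [:: s01; s11; s12]; [:: s02; s12; s22]] i) j.

Lemma sym3_mxP s00 s01 s02 s11 s12 s22 :
  sym3_mx s00 s01 s02 s11 s12 s22 \in @sym2_pred K 3.
Proof.
apply/eqP/matrixP => i j; rewrite !mxE.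
by move: i j; apply: ord3_ind; apply: ord3_ind.
Qed.

Definition gl3_mx (p00 p01 p02 p10 p11 p12 p20 p21 p22 : K) : 'M[K]_3 :=
  \matrix_(i < 3, j < 3) nth 0 (nth [::] [::
    [:: p00; p01; p02]; [:: p10; p11; p12]; [:: p20; p21; p22]] i) j.

Lemma prolongation_a5t_gl :
  lie_isomorphic (subLie (prolongation (tr_sub (a5 K)))) (semidirect (gl_sym2 K 3)).
Proof.
pose f (z : semidirect (gl_sym2 K 3)) := gl_vf z.1 (val z.2).
have f_lin : linear f by move=> c x y; rewrite /f -gl_vf_lin.
pose fM := GRing.isLinear.Build K _ _ *:%R f f_lin.
pose F : {linear semidirect (gl_sym2 K 3) -> polyvf K 5} := HB.pack f fM.
apply: (@lie_isomorphic_subLie K _ _ (prolongation (tr_sub (a5 K))) F).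
- apply: raddf_inj => -[M S]; rewrite /= /f /=.
  case/(gl_vf_eq0 (sym2_valP S)) => -> S0.
  by congr pair; apply: val_inj.
- move=> [M S]; apply/(prolong_setP _ (@a5t_second_prolong_trivial K)).
  rewrite /= /f /gl_vf; do 3 eexists; split; last reflexivity; last exact: a5t_tensorP.
  by eexists; last reflexivity; do 7 eexists.
- move=> X /(prolong_setP _ (@a5t_second_prolong_trivial K)) [v [_ [T [
    [_ [a [b [c [p [q [e1 [e2 ->]]]]]]] ->] /a5t_tensor_uniq -> ->]]]].
  move: (T o0 o1 o1) (T o0 o0 o1) (- T o0 o2 o0 / 2) => t u s.
  (* The witnesses solve the formula of [gl_vf]; the coordinate [x3] is twice an off-diagonal entry,
     whence [- v o3 0 / 2]. *)
  pose M := gl3_mx (- (2 * a + e2) / 2) (- b) (- v o0 0) (- c) ((2 * a - e2) / 2) (- v o1 0)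
    t u (e1 - e2 / 2).
  pose S : sym2 K 3 := Sym2 (sym3_mxP (- v o2 0) (- v o3 0 / 2) (p / 2) (- v o4 0) (q / 2) s).
  exists (M, S); rewrite /= /f /gl_vf /M !mxE /=.
  congr (const_vf _ + linear_vf _ + quad_vf _).
    apply/colP => i; rewrite !mxE; move: i; apply: ord5_ind; rewrite /= ?opprK //.
    by field.
  by congr (_^T); congr a5_mx; field.
move=> [M S] [N T]; rewrite /= /f /=.
exact: gl_vf_lie (sym2_valP S) (sym2_valP T).
Qed.

Lemma gl_sym2_dimension : has_dimension (semidirect (gl_sym2 K 3)) 15.
Proof.
constructor.
exists (fun z : semidirect (gl_sym2 K 3) => let M := z.1 in let S := val z.2 in
  \row_(i < 15) nth 0 [:: M j0 j0; M j0 j1; M j0 j2; M j1 j0; M j1 j1; M j1 j2;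
    M j2 j0; M j2 j1; M j2 j2; S j0 j0; S j0 j1; S j0 j2; S j1 j1; S j1 j2; S j2 j2] i).
  move=> c [M S] [N T]; apply/rowP => -[m lt_m]; rewrite !mxE /=.
  by do 15 (case: m lt_m => [|m] lt_m; first by rewrite /= ?mxE).
pose r (x : 'rV[K]_15) m (lt_m : (m < 15)%N) := x 0 (Ordinal lt_m).
exists (fun x : 'rV[K]_15 => (gl3_mx (@r x 0 isT) (@r x 1 isT) (@r x 2 isT) (@r x 3 isT)
   (@r x 4 isT) (@r x 5 isT) (@r x 6 isT) (@r x 7 isT) (@r x 8 isT),
   Sym2 (sym3_mxP (@r x 9 isT) (@r x 10 isT) (@r x 11 isT) (@r x 12 isT) (@r x 13 isT)
     (@r x 14 isT)))).
  move=> [M S]; congr pair.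
    apply/matrixP => i j; rewrite /r !mxE /=.
    by move: i j; apply: ord3_ind; apply: ord3_ind.
  have S10 i j : val S i j = val S j i by rewrite -{1}sym2_valP mxE.
  apply: val_inj; apply/matrixP => i j; rewrite /r /sym3_mx !mxE /=.
  by move: i j; apply: ord3_ind; apply: ord3_ind; rewrite //= S10.
move=> x; apply/rowP => -[m lt_m]; rewrite !mxE /=.
do 15 (case: m lt_m => [|m] lt_m; first by rewrite /= /r; congr (x 0 _); apply: val_inj).
by [].
Qed.

End ProlongationIsomorphisms.

(** * Abelian ideals *)

Section CspNilpotent.
Variable K : realFieldType.

Lemma tr_symplectic_form m : (symplectic_form K m)^T = - symplectic_form K m.
Proof.
by rewrite /symplectic_form tr_block_mx !trmx0 linearN /= trmx1 opp_block_mx !oppr0 opprK.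
Qed.

Lemma symplectic_form_sqr m : symplectic_form K m *m symplectic_form K m = - 1%:M.
Proof.
rewrite /symplectic_form mulmx_block !mul0mx !mulmx0 !mulNmx !mul1mx !add0r !addr0.
by rewrite scalar_mx_block opp_block_mx !oppr0.
Qed.

(** With J the symplectic form, this is the rank one map sending x to (u^T J x) u, the generator of
    symplectic transvections. *)
Lemma sp_rank1 m (u : 'cV[K]_(m + m)) : sp_set (u *m u^T *m symplectic_form K m).
Proof.
rewrite /sp_set !trmx_mul trmxK tr_symplectic_form.
by rewrite !mulNmx !mulmxA addNr.
Qed.

Lemma outer_eq0 n (w : 'cV[K]_n) : w *m w^T = 0 -> w = 0.
Proof.
move=> /matrixP e; apply/colP => i; have := e i i.
by rewrite !mxE big_ord1 mxE => /eqP; rewrite mulf_eq0 orbb => /eqP.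
Qed.

(** Testing [B] = u u^T J yields w w^T = 2c w u^T for w = A u, where c is the scalar part of [A].
    This forces w = 0 for every u. *)
Lemma csp_nilpotent_eq0 m (A : 'M[K]_(m + m)) : csp_set A -> A *m A = 0 ->
  (forall B, sp_set B -> A *m B *m A = 0) -> A = 0.
Proof.
set J := symplectic_form K m => -[B [c [sB eA]]] AA ABA.
have JA : J *m A = (2 * c) *: J - A^T *m J.
  move/eqP: sB; rewrite addr_eq0 => /eqP sB.
  rewrite eA [(_ + _)^T]linearD /= tr_scalar_mx mulmxDr mulmxDl sB mul_scalar_mx mul_mx_scalar.
  by rewrite opprD opprK [RHS]addrCA -scalerBl; congr (_ + _ *: _); ring.
suff Au (u : 'cV_(m + m)) : A *m u = 0.
  apply/matrixP => i j; have /colP/(_ i) := Au (delta_mx j 0).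
  by rewrite -colE !mxE.
set w := A *m u; have Aw : A *m w = 0 by rewrite mulmxA AA mul0mx.
have wwE : w *m w^T = (2 * c) *: (w *m u^T).
  have := ABA _ (sp_rank1 u).
  rewrite -!mulmxA JA !mulmxBr -!scalemxAr => /eqP; rewrite subr_eq0 => /eqP.
  move/(congr1 (fun N => N *m J)).
  rewrite -!scalemxAl -!mulmxA symplectic_form_sqr !mulmxN !mulmx1 => /eqP.
  rewrite scalerN eqr_opp => /eqP; rewrite /w trmx_mul !mulmxA.
  by move=> <-.
(* If c is nonzero, multiplying on the right by A^T gives 2c w w^T = w (A w)^T = 0. *)
have [c0|c0] := eqVneq c 0; first by apply: outer_eq0; rewrite wwE c0 mulr0 scale0r.
have : w *m w^T *m A^T = 0 by rewrite -mulmxA -trmx_mul Aw trmx0 mulmx0.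
rewrite wwE -scalemxAl -mulmxA -trmx_mul => /eqP; rewrite scaler_eq0 mulf_eq0.
by rewrite pnatr_eq0 (negPf c0) /= => /eqP /outer_eq0.
Qed.

End CspNilpotent.

Section SemidirectLie.
Variables (K : fieldType) (L : lieAlgType K) (M : lmodType K) (rho : lieRep L M).

Lemma semidirect_lieE (a b : L) (m n : M) :
  [lie (a, m) : semidirect rho, (b, n)] = ([lie a, b], rho a n - rho b m).
Proof. by []. Qed.

Lemma rep0l m : rho 0 m = 0.
Proof. by have := rep_linearl rho (-1) 0 0 m; rewrite scaler0 addr0 scaleN1r addNr. Qed.

End SemidirectLie.

(** * Non-isomorphism of the two semidirect products *)

Section NonIsomorphic.
Variable K : realFieldType.

(* Every element x of an abelian ideal satisfies the hypothesis. *)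
Lemma csp_abelian_ideal m (x : semidirect (csp_std K m)) :
  (forall y, [lie [lie x, y], x] = 0) -> x.1 = 0.
Proof.
case: x => [A v] xP; apply: val_inj => /=.
(* For y = (0, e) the double bracket is (0, - A A e). *)
have AA : val A *m val A = 0.
  apply/matrixP => i j; have := xP (0, delta_mx j 0).
  rewrite !semidirect_lieE liex0 !rep0l subr0 sub0r => /(congr1 snd) /= /eqP.
  rewrite oppr_eq0 => /eqP /colP/(_ i); rewrite /= /csp_act !mxE => {2}<-.
  apply: eq_bigr => k _; congr (_ * _).
  by rewrite -colE mxE.
apply: (csp_nilpotent_eq0 _ AA); first exact/asboolP/(valP A).
move=> B sB; have BP : B \in lieSub_pred (csp K m).
  by apply/asboolP; exists B, 0; rewrite raddf0 addr0.
(* For y = (B, 0) the first component is [[A, B], A], which equals 2 A B A because A A = 0. *)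
have := xP (SubLie BP, 0); rewrite !semidirect_lieE => /(congr1 (fun z => val z.1)) /=.
rewrite !lie_mxE mulmxBl mulmxBr -!mulmxA AA mulmx0 subr0 !mulmxA AA.
rewrite mul0mx sub0r opprK -mulr2n => /eqP.
by rewrite -scaler_nat scaler_eq0 pnatr_eq0 => /eqP.
Qed.

(** An isomorphism would embed the abelian ideal of symmetric matrices, of dimension 6, into the
    4-dimensional translation ideal. *)
Lemma csp_std_gl_sym2_not_isomorphic :
  ~ lie_isomorphic (semidirect (gl_sym2 K 3)) (semidirect (csp_std K 2)).
Proof.
move=> [f [fb fB]].
have f0 (S : sym2 K 3) : (f (0, S)).1 = 0.
  apply: csp_abelian_ideal => y; have [g fK gK] := fb.
  rewrite -(gK y) -!fB; case: (g y) => M T.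
  rewrite -[RHS](raddf0 f); congr (f _).
  by rewrite !semidirect_lieE !lie0x !rep0l subrr.
(* Five dimensions already exceed 4, so the last diagonal entry is fixed to 0. *)
pose h (r : 'rV[K]_5) : sym2 K 3 := Sym2 (sym3_mxP (r 0 o0) (r 0 o1) (r 0 o2) (r 0 o3) (r 0 o4) 0).
pose F r := (f (0, h r)).2^T.
have F_lin : linear F.
  move=> c r s; rewrite /F -linearP; congr (_^T).
  have -> : h (c *: r + s) = c *: h r + h s.
    apply: val_inj; apply/matrixP => i j; rewrite /= !mxE.
    by move: i j; apply: ord3_ind; apply: ord3_ind; rewrite //= mulr0 addr0.
  have -> : (0, c *: h r + h s) = c *: (0, h r) + (0, h s) :> semidirect (gl_sym2 K 3).
    by congr pair; rewrite /= scaler0 addr0.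
  by rewrite linearP.
pose FM := GRing.isLinear.Build K _ _ *:%R F F_lin.
pose Fl : {linear 'rV[K]_5 -> 'rV[K]_(2 + 2)} := HB.pack F FM.
(* A 5 by 4 matrix has a nonzero left kernel; a vector [r] in it gives [f (0, h r) = 0], against
   injectivity. *)
have : kermx (lin1_mx Fl) != 0.
  rewrite kermx_eq0 /row_free; apply/eqP => e.
  by have := rank_leq_col (lin1_mx Fl); rewrite e.
case/rowV0Pn => r /sub_kermxP; rewrite mul_rV_lin1 /= /F => Fr /eqP; apply.
have : f (0, h r) = 0.
  rewrite [LHS]surjective_pairing f0; congr pair.
  by rewrite -[LHS]trmxK Fr trmx0.
rewrite -[RHS](raddf0 f) => /(bij_inj fb)/(congr1 (fun z => val z.2)) /= /matrixP e.
apply/rowP => i; rewrite mxE; move: i; apply: ord5_ind.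
- by have := e j0 j0; rewrite !mxE.
- by have := e j0 j1; rewrite !mxE.
- by have := e j0 j2; rewrite !mxE.
- by have := e j1 j1; rewrite !mxE.
by have := e j1 j2; rewrite !mxE.
Qed.

End NonIsomorphic.

Theorem mainTheorem5 (R : realType) :
  [/\ has_dimension (subLie (prolongation (a5 R))) 15,
      has_dimension (subLie (prolongation (tr_sub (a5 R)))) 15,
      ~ lie_isomorphic (subLie (prolongation (a5 R)))
                       (subLie (prolongation (tr_sub (a5 R)))),
      lie_isomorphic (subLie (prolongation (a5 R)))
                     (semidirect (csp_std R 2)) &
      lie_isomorphic (subLie (prolongation (tr_sub (a5 R))))
                     (semidirect (gl_sym2 R 3))].
Proof.
have iso1 := prolongation_a5_csp R; have iso2 := prolongation_a5t_gl R.
split=> //.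
- exact: has_dimension_isomorphic iso1 (csp_std_dimension R).
- exact: has_dimension_isomorphic iso2 (gl_sym2_dimension R).
move=> /lie_isomorphic_sym iso12.
apply: (@csp_std_gl_sym2_not_isomorphic R).
exact: lie_isomorphic_trans (lie_isomorphic_sym iso2) (lie_isomorphic_trans iso12 iso1).
Qed.
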